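(* Let $n\ge 1$, $c\ge 0$ and $k$ be integers with $0\le k\le c$. The number of strict plane partitions with parts in $\{1,2,\dots,n\}$, at most $c$ columns and exactly $k$ parts equal to $n$ is given by $$ F(n-1,n,c;k)=\frac{(1+k)_{n-1}\,(1+c-k)_{n-1}}{(1)_{n-1}}\prod_{i=1}^{n-1}\frac{(c+i+1)_{i-1}}{(i)_i}. $$
   Context: A strict plane partition of shape $\lambda=(\lambda_1\ge\lambda_2\ge\dots\ge\lambda_r)$ (a partition) is an array $(\pi_{i,j})_{1\le i\le r,\,1\le j\le\lambda_i}$ of non-negative integers whose rows are weakly decreasing and whose columns are strictly decreasing. Here all parts (entries) lie in $\{1,\dots,n\}$; shapes are partitions with positive parts, and the empty partition is allowed. ''At most $c$ columns'' means $\lambda_1\le c$. $(a)_m=\prod_{i=0}^{m-1}(a+i)$ is the Pochhammer symbol ($m\ge0$, empty product $1$). Generalized patterns. Let $r,n,c$ be integers, $r\ge0$, $n\ge1$, $r\le n$. A generalized $(r,n,c)$ Gelfand-Tsetlin-pattern ($(r,n,c)$-pattern) is an array $(a_{i,j})_{1\le i\le r+1,\;i-1\le j\le n+1}$ of integers with (1) $a_{i,i-1}=0$ and $a_{i,n+1}=c$ for all $i$; and, for all $2\le i\le r+1$ and $i-1\le j\le n$: (2) if $a_{i,j}\le a_{i,j+1}$ then $a_{i,j}\le a_{i-1,j}\le a_{i,j+1}$; (3) if $a_{i,j}>a_{i,j+1}$ then $a_{i,j}>a_{i-1,j}>a_{i,j+1}$. Row $r+1$ is called the top row. An inversion is a pair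 $(a_{i,j},a_{i,j+1})$ with $i\ne1$ and $a_{i,j}>a_{i,j+1}$; the sign is $\mathrm{sgn}(a)=(-1)^{\#\text{inversions}}$. For integers $k_1,\dots,k_{n-r}$, $F(r,n,c;k_1,\dots,k_{n-r})=\sum_a\mathrm{sgn}(a)$, summed over all $(r,n,c)$-patterns $a$ with $a_{r+1,r+i}=k_i$ for $i=1,\dots,n-r$. *)

(* Defs.v *)
(* MathComp, with the classical sets of MathComp-Analysis *)
From mathcomp Require Import all_boot all_order all_algebra finmap.
From mathcomp Require Import zify.
From mathcomp Require Import boolp classical_sets functions cardinality fsbigop.

Set Implicit Arguments.
Unset Strict Implicit.
Unset Printing Implicit Defensive.

Import Order.TTheory GRing.Theory Num.Theory.

Local Open Scope ring_scope.

Definition pochhammer (R : pzRingType) (a : R) (m : nat) : R :=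
  \prod_(0 <= i < m) (a + i%:R).

(* A plane partition is the sequence of its rows, numbered from 0, so that its
   shape is the sequence of the sizes of the rows. *)
Definition part (pi : seq (seq nat)) (i j : nat) : nat := nth 0 (nth [::] pi i) j.

Definition is_partition (la : seq nat) : bool := sorted geq la && (0 \notin la)%N.

Definition strict_plane_partition (pi : seq (seq nat)) : Prop :=
  [/\ is_partition (shape pi),
      forall i j : nat, (i < size pi)%N -> (j.+1 < nth 0 (shape pi) i)%N ->
        (part pi i j.+1 <= part pi i j)%N
    & forall i j : nat, (i.+1 < size pi)%N -> (j < nth 0 (shape pi) i.+1)%N ->
        (part pi i.+1 j < part pi i j)%N ].

Definition strict_plane_partitions (n c k : nat) : set (seq (seq nat)) :=
  [set pi | [/\ strict_plane_partition pi,
                all (fun x => (1 <= x <= n)%N) (flatten pi),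
                (head 0 (shape pi) <= c)%N
              & count_mem n (flatten pi) = k]]%classic.

(* The entry a_{i,j} of an array is a i j, with the 1-based row index i; outside
   the index range 1 <= i <= r+1, i-1 <= j <= n+1 the array is extended by 0, so
   that equal arrays are equal as functions. *)
Definition gt_index (r n i j : nat) : bool :=
  (1 <= i <= r.+1)%N && (i.-1 <= j <= n.+1)%N.

Definition gt_pattern (r n : nat) (c : int) (a : nat -> nat -> int) : Prop :=
  [/\ forall i j : nat, ~~ gt_index r n i j -> a i j = 0,
      forall i : nat, (1 <= i <= r.+1)%N -> a i i.-1 = 0 /\ a i n.+1 = c,
      forall i j : nat, (2 <= i <= r.+1)%N -> (i.-1 <= j <= n)%N ->
        a i j <= a i j.+1 -> a i j <= a i.-1 j <= a i j.+1
    & forall i j : nat, (2 <= i <= r.+1)%N -> (i.-1 <= j <= n)%N ->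
        a i j > a i j.+1 -> a i j.+1 < a i.-1 j < a i j ].

Definition gt_inversions (r n : nat) (a : nat -> nat -> int) : nat :=
  \sum_(2 <= i < r.+2) \sum_(i.-1 <= j < n.+1) (a i j > a i j.+1)%R.

Definition gt_sgn (r n : nat) (a : nat -> nat -> int) : int :=
  (-1) ^+ gt_inversions r n a.

(* k_1, ..., k_{n-r} are k 0, ..., k (n-r-1) *)
Definition gt_patterns_top (r n : nat) (c : int) (k : 'I_(n - r) -> int) :
    set (nat -> nat -> int) :=
  [set a | gt_pattern r n c a /\
           forall i : 'I_(n - r), a r.+1 (r + i.+1)%N = k i]%classic.

(* The sum is a genuine finite sum by finite_gt_patterns_top. *)
Definition F (r n : nat) (c : int) (k : 'I_(n - r) -> int) : int :=
  \sum_(a \in gt_patterns_top c k) gt_sgn r n a.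

Lemma finite_gt_patterns_top (r n : nat) (c : int) (k : 'I_(n - r) -> int) :
  (r <= n)%N -> finite_set (gt_patterns_top c k).
Proof.
move=> rn.
pose M : nat := (`|c| + \sum_i `|k i|)%N.
have kM (i : 'I_(n - r)) : (`|k i| <= M)%N.
  by rewrite /M (bigD1 i) //=; lia.
pose g (f : {ffun 'I_r.+2 * 'I_n.+2 -> 'I_(M + M).+1}) (i j : nat) : int :=
  if gt_index r n i j then (f (inord i, inord j) : nat)%:Z - M%:Z else 0.
apply: (@sub_finite_set _ _ (g @` setT)%classic); last first.
  by apply: finite_image; exact: finite_finset.
move=> a [[a0 a1 a2 a3] ak].
have bd d i j : (i + d)%N = r.+1 -> gt_index r n i j -> (`|a i j| <= M)%N.
  elim: d i j => [|d IH] i j eqi /andP[/andP[i0 ir] /andP[ij jn]].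
    have ei : i = r.+1 by lia.
    have [b0 bc] := a1 i ltac:(lia).
    have [->|jr] := eqVneq j i.-1; first by rewrite b0.
    have [->|jN] := eqVneq j n.+1; first by rewrite bc /M; lia.
    have jb : (j - r.+1 < n - r)%N by lia.
    have := ak (Ordinal jb); rewrite /= (_ : (r + (j - r.+1).+1)%N = j); last lia.
    by rewrite ei => ->.
  have [b0 bc] := a1 i ltac:(lia).
  have [->|jr] := eqVneq j i.-1; first by rewrite b0.
  have [->|jN] := eqVneq j n.+1; first by rewrite bc /M; lia.
  have h1 := IH i.+1 j ltac:(lia) ltac:(rewrite /gt_index; lia).
  have h2 := IH i.+1 j.+1 ltac:(lia) ltac:(rewrite /gt_index; lia).
  have h3 := a2 i.+1 j ltac:(lia) ltac:(lia).
  have h4 := a3 i.+1 j ltac:(lia) ltac:(lia).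
  rewrite /= in h3 h4.
  by have [/h3|/h4] := leP (a i.+1 j) (a i.+1 j.+1); lia.
exists [ffun x : 'I_r.+2 * 'I_n.+2 => inord `|a x.1 x.2 + M%:Z|] => //.
apply/funext => i; apply/funext => j; rewrite /g.
case: ifPn => [ij|/a0 ->//].
have := bd (r.+1 - i)%N i j ltac:(rewrite /gt_index in ij; lia) ij => bij.
rewrite ffunE /= !inordK; try (rewrite /gt_index in ij; lia).
Qed.

(* Main.v *)
Require Import Defs.
From HB Require Import structures.
From mathcomp Require Import all_boot all_order all_algebra finmap.
From mathcomp Require Import zify ring.
From mathcomp Require Import boolp classical_sets functions cardinality fsbigop.

(** The array with entry #{parts >= i in row n + 1 - j} at position (i, j)
    turns the plane partitions into the patterns with top row k: since
    0 <= k <= c, all rows of such a pattern increase weakly and there is no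
    inversion.  So F (n - 1, n, c; k) counts both, and the product formula
    remains.  Write m = n - 1 and N = c + n.

    Put y_q = a_{1, q + 1} + q.  Then the longest row of the array becomes an
    n-subset y_0 < ... < y_m of [0, N), and interlacing of rows becomes
    y_q <= x_q < y_{q + 1}.  By iterated summation, the number of arrays with
    longest row y is the determinant of the vectors
      (C(y_q, 0), ..., C(y_q, m - 1), apex_k(y_q)),
    where apex_k is the m-fold partial sum of the indicator of k
    ([count_rows_wedges]).  Determinants are taken as top coefficients of
    products in an exterior algebra.  There the sum over all subsets y is the
    top coefficient of the ordered product of the factors 1 + e_s, s < N, and
    extraction of the last coordinate turns it into
      sum_{y < N} apex_k(y) w(y),
    with w(y) the top coefficient of
      prod_{s < y} (1 + e_s) prod_{y < s < N} (1 - e_s),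
    e_s = (C(s, 0), ..., C(s, m - 1)) ([count_arrays_weight]).

    Two facts determine w up to a factor: it is a discrete Legendre polynomial.
    - w is orthogonal to all polynomials of degree < m, because a determinant
      with two equal coordinates vanishes ([weight_ortho]).
    - w is a polynomial of degree <= m: with v = e_y + e_{y + 1} one has
        w(y + 1) - w(y) = top (v prod_{s < N} (1 - e_s)),
      since v (1 - e_y) (1 - e_{y + 1}) = v; the product on the right does not
      depend on y, so the difference has degree < m ([weight_succ]).

    Hence (-1)^m times the number of arrays with apex k is, for 0 <= k < N, the
    value at k + m of a polynomial of degree <= 2m, the m-fold partial sum of
    w.  It vanishes at 0, ..., m - 1, and at N, ..., N + m - 1 because no array
    has an apex k > c.  So it is a multiple, by a factor independent of k, of
    the product of the corresponding linear factors, that is, of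
    (1 + k)_m (1 + c - k)_m ([count_arrays_product]).  The factor follows by
    induction on n from the remark that a plane partition with parts <= n + 1
    and no part n + 1 is a plane partition with parts <= n and some number
    k <= c of parts n ([count_arrays_rec]). *)

Set Implicit Arguments.
Unset Strict Implicit.
Unset Printing Implicit Defensive.

Import Order.TTheory GRing.Theory Num.Theory.

Local Open Scope ring_scope.

(** * The exterior algebra *)

(** An element of the exterior algebra on generators g_0, g_1, ... is stored as
    its coefficient function: the bit sequence bs stands for the increasing
    product of the g_i with i-th bit set, among as many generators as bs has
    bits.  [wedge e f] is the left product of f by
    the vector sum_i (e i) g_i; the sign comes from moving g_i past the
    generators before it.  Left products by vectors are the only products that
    are needed, so the algebra itself is not constructed. *)
Fixpoint wedge (R : comPzRingType) (e : nat -> R) (f : bitseq -> R) (bs : bitseq) : R :=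
  if bs is b :: bs' then
    b%:R * e 0%N * f (false :: bs') + (-1) ^+ b * wedge (e \o succn) (f \o cons b) bs'
  else 0.

Definition ext_unit (R : comPzRingType) (bs : bitseq) : R := (count id bs == 0%N)%:R.

Lemma eq_wedge (R : comPzRingType) (e h : nat -> R) f g bs :
  (forall i, (i < size bs)%N -> e i = h i) ->
  (forall bs', size bs' = size bs -> f bs' = g bs') ->
  wedge e f bs = wedge h g bs.
Proof.
elim: bs e h f g => //= b bs IH e h f g eqe eqf.
rewrite eqe // eqf //; congr (_ + _ * _).
apply: IH => [i ib|bs' sz] /=; first by rewrite eqe.
by rewrite eqf //= sz.
Qed.

Lemma wedge_is_zmod_morphism (R : comPzRingType) (e : nat -> R) :
  zmod_morphism (wedge e).
Proof.
move=> f g; apply/funext => bs; rewrite ![in RHS]fctE.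
elim: bs e f g => [|b bs IH] e f g /=; first by ring.
rewrite [X in wedge _ X](_ : _ = (f \o cons b) - (g \o cons b)) // IH.
by case: b; rewrite /= ?fctE; ring.
Qed.
HB.instance Definition _ (R : comPzRingType) (e : nat -> R) :=
  GRing.isZmodMorphism.Build (bitseq -> R) (bitseq ->
    R) (wedge e) (wedge_is_zmod_morphism e).

Lemma wedgeZ (R : comPzRingType) (e : nat -> R) (a : R) f :
  wedge e (a \*o f) = a \*o wedge e f.
Proof.
apply/funext => bs /=; elim: bs e f => [|b bs IH] e f /=; first by ring.
by rewrite [X in wedge _ X](_ : _ = a \*o (f \o cons b)) // IH; case: b; rewrite /=; ring.
Qed.

Lemma wedgeDl (R : comPzRingType) (e h : nat -> R) f :
  wedge (e + h) f = wedge e f + wedge h f.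
Proof.
apply/funext => bs; rewrite ![in RHS]fctE.
elim: bs e h f => [|b bs IH] e h f /=; first by ring.
rewrite [X in wedge X](_ : _ = (e \o succn) + (h \o succn)) // IH.
by case: b; rewrite /= ?fctE; ring.
Qed.

Lemma wedgeNl (R : comPzRingType) (e : nat -> R) f : wedge (- e) f = - wedge e f.
Proof.
apply/funext => bs; rewrite ![in RHS]fctE.
elim: bs e f => [|b bs IH] e f /=; first by ring.
rewrite [X in wedge X](_ : _ = - (e \o succn)) // IH.
by case: b; rewrite /= ?fctE; ring.
Qed.

Lemma wedgeE (R : comPzRingType) (e : nat -> R) f b bs :
  wedge e f (b :: bs) = b%:R * e 0%N * f (false :: bs)
    + (-1) ^+ b * wedge (e \o succn) (f \o cons b) bs.
Proof. by []. Qed.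

Lemma wedge_cons (R : comPzRingType) (e : nat -> R) f b :
  wedge e f \o cons b = (b%:R * e 0%N) \*o (f \o cons false) +
    (-1) ^+ b \*o wedge (e \o succn) (f \o cons b).
Proof. by apply/funext => bs; rewrite [in RHS]fctE. Qed.

Lemma wedgeC (R : comPzRingType) (e h : nat -> R) f :
  wedge e (wedge h f) = - wedge h (wedge e f).
Proof.
apply/funext => bs; rewrite ![in RHS]fctE.
elim: bs e h f => [|b bs IH] e h f /=; first by ring.
rewrite !wedge_cons !raddfD /= !wedgeZ ![in LHS]fctE ![in RHS]fctE /= IH.
by case: b; rewrite /=; ring.
Qed.

Lemma wedge_wedge (R : comPzRingType) (e : nat -> R) f : wedge e (wedge e f) = 0.
Proof.
apply/funext => bs.
elim: bs e f => [|b bs IH] e f //=.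
rewrite !wedge_cons !raddfD /= !wedgeZ ![in LHS]fctE /= IH.
by case: b; rewrite /=; ring.
Qed.

(** Splitting off the last generator rather than the first: it has to pass all
    the generators of bs, whence the sign. *)
Lemma wedge_rcons (R : comPzRingType) (e : nat -> R) f bs b :
  wedge e f (rcons bs b) = wedge e (f \o rcons^~ b) bs
    + b%:R * ((-1) ^+ count id bs * e (size bs) * f (rcons bs false)).
Proof.
elim: bs e f => [|b' bs IH] e f /=; first by case: b; ring.
by rewrite IH /= exprD; case: b b' {IH} => -[] /=; ring.
Qed.

(** Linearity in the vector, in coordinates: the coefficients on the right do not
    involve e, which is how a coefficient of a product of a varying vector by a
    fixed element becomes a fixed combination of the coordinates. *)
Lemma wedge_scalar (R : comPzRingType) (e : nat -> R) f bs :
  wedge e f bs = \sum_(i < size bs) e i * wedge (fun j => (j == i :> nat)%:R) f bs.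
Proof.
elim: bs e f => [|b bs IH] e f /=; first by rewrite big_ord0.
rewrite big_ord_recl /= IH.
have -> : wedge ((fun j => (j == 0)%:R : R) \o succn) (f \o cons b) bs = 0.
  by rewrite IH big1 // => i _ /=; rewrite mul0r.
rewrite [in RHS](eq_bigr (fun i : 'I_(size bs) => (-1) ^+ b *
   (e i.+1 * wedge (fun j => (j == i :> nat)%:R) (f \o cons b) bs))).
  by rewrite -big_distrr /=; ring.
by move=> i _; rewrite /=; ring.
Qed.

(** The interior product by the dual of g_j. *)
Fixpoint contract (R : comPzRingType) (j : nat) (f : bitseq -> R) (bs : bitseq) : R :=
  if bs is b :: bs' then
    if j is j'.+1 then (-1) ^+ b * contract j' (f \o cons b) bs'
    else (~~ b)%:R * f (true :: bs')
  else 0.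

Lemma contractD (R : comPzRingType) j (f g : bitseq -> R) :
  contract j (f + g) = contract j f + contract j g.
Proof.
apply/funext => bs; rewrite ![in RHS]fctE.
elim: bs j f g => [|b bs IH] [|j] f g /=; try by [ring|case: b; rewrite ?fctE; ring].
by rewrite [X in contract _ X](_ : _ = (f \o cons b) + (g \o cons b)) // IH; ring.
Qed.

Lemma contractZ (R : comPzRingType) j a (f : bitseq -> R) :
  contract j (a \*o f) = a \*o contract j f.
Proof.
apply/funext => bs /=.
elim: bs j f => [|b bs IH] [|j] f /=; try by [ring|case: b; ring].
by rewrite [X in contract _ X](_ : _ = a \*o (f \o cons b)) // IH /=; ring.
Qed.

(** Interior products are antiderivations.  The bound on j is needed because a bit
    sequence of size <= j has no room to record g_j. *)
Lemma contract_wedge (R : comPzRingType) j (e : nat -> R) f bs :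
  (j < size bs)%N ->
  contract j (wedge e f) bs + wedge e (contract j f) bs = e j * f bs.
Proof.
elim: bs j e f => [|b bs IH] [|j] e f //=.
  rewrite [contract 0 f \o cons b](_ : _ = (~~ b)%:R \*o (f \o cons true)).
    by rewrite wedgeZ /= => _; case: b; rewrite /=; ring.
  by apply/funext.
move=> jb; have /= := IH j (e \o succn) (f \o cons b) jb.
rewrite wedge_cons.
rewrite [contract j.+1 f \o cons b](_ : _ = (-1) ^+ b \*o contract j (f \o cons b)).
  by rewrite wedgeZ contractD !contractZ ![in X in _ -> X]fctE /= => <-; case: b;
    rewrite /=; ring.
by apply/funext.
Qed.

Lemma contract_cat (R : comPzRingType) (f : bitseq -> R) a b bs :
  contract (size a) f (a ++ b :: bs) =
  (~~ b)%:R * (-1) ^+ count id a * f (a ++ true :: bs).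
Proof.
elim: a f => [|x a IH] f /=; first by case: b; ring.
by rewrite (IH (f \o cons x)) /= exprD; ring.
Qed.

(** A product by a vector raises the degree by one.  The shift c makes the
    statement pass to the functions f \o cons b in the induction. *)
Lemma wedge_homog (R : comPzRingType) (e : nat -> R) f c d :
  (forall bs, (count id bs + c != d)%N -> f bs = 0) ->
  forall bs, (count id bs + c != d.+1)%N -> wedge e f bs = 0.
Proof.
move=> hf bs; elim: bs e f c hf => [|b bs IH] e f c hf //= hbs.
rewrite (IH _ _ (b + c)%N) ?mulr0 ?addr0; last by rewrite addnA [(_ + b)%N]addnC.
  case: b hbs => hbs; last by rewrite !mul0r.
  by rewrite hf ?mulr0 //=; apply: contra hbs => /eqP <-.
by move=> bs' h /=; apply: hf; move: h => /=; lia.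
Qed.

(** * Ordered products *)

Definition wedges (R : comPzRingType) (e : nat -> nat -> R) (l : seq nat) (f : bitseq ->
  R) :=
  foldr (fun s => wedge (e s)) f l.

(** The product of the 1 + e_s, with s in the order of l, times f. *)
Definition oprod (R : comPzRingType) (e : nat -> nat -> R) (l : seq nat) (f : bitseq ->
  R) :=
  foldr (fun s g => g + wedge (e s) g) f l.

(** The subsequences of an increasing sequence are its subsets in increasing
    order, which is the order in which their vectors have to be multiplied. *)
Fixpoint subseqs (l : seq nat) : seq (seq nat) :=
  if l is s :: l' then subseqs l' ++ [seq s :: y | y <- subseqs l'] else [:: [::]].

Lemma sum_subseqs (R : comPzRingType) (e : nat -> nat -> R) l f :
  \sum_(y <- subseqs l) wedges e y f = oprod e l f.
Proof.
elim: l => [|s l IH] /=; first by rewrite big_seq1.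
by rewrite big_cat big_map IH /= -raddf_sum IH.
Qed.

Lemma wedges_homog (R : comPzRingType) (e : nat -> nat -> R) y bs :
  count id bs != size y -> wedges e y (@ext_unit R) bs = 0.
Proof.
rewrite -[count id bs]addn0; elim: y bs => [|a y IH] bs /=; last exact: wedge_homog.
by rewrite addn0 /ext_unit => /negbTE ->.
Qed.

Lemma oprod_cat (R : comPzRingType) (e : nat -> nat -> R) l1 l2 f :
  oprod e (l1 ++ l2) f = oprod e l1 (oprod e l2 f).
Proof. exact: foldr_cat. Qed.

Lemma oprodB (R : comPzRingType) (e : nat -> nat -> R) l f g :
  oprod e l (f - g) = oprod e l f - oprod e l g.
Proof. by elim: l => //= s l ->; rewrite raddfB /= opprD addrACA. Qed.

(** (1 + e_s) v = v (1 - e_s) for all vectors v. *)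
Lemma oprod_wedge (R : comPzRingType) (e : nat -> nat -> R) l v f :
  oprod e l (wedge v f) = wedge v (oprod (- e) l f).
Proof.
elim: l => //= s l ->.
by rewrite (wedgeC (e s)) wedgeNl raddfB.
Qed.

(** Let v = e_a + e_b.  Then v e_a + v e_b = v v = 0 and v e_a e_b = 0, so v absorbs
    (1 - e_a) (1 - e_b).  This is what makes the differences of the weight
    independent of the deleted pair of consecutive integers. *)
Lemma wedge_oprod2 (R : comPzRingType) (e : nat -> nat -> R) a b f :
  wedge (e a + e b) (oprod (- e) [:: a; b] f) = wedge (e a + e b) f.
Proof.
rewrite /= [(- e) a]/(- e a) [(- e) b]/(- e b) !wedgeNl !raddfD /= !raddfN /=.
rewrite [wedge (e a + e b) (wedge (e a) (wedge _ _))](_ : _ = 0); last first.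
  by rewrite wedgeDl wedge_wedge (wedgeC (e b)) wedge_wedge raddf0 oppr0 addr0.
have -> : wedge (e a + e b) (wedge (e b) f) = - wedge (e a + e b) (wedge (e a) f).
  by rewrite !wedgeDl !wedge_wedge (wedgeC (e b)) addr0 add0r opprK.
by rewrite !opprK addr0 addrK.
Qed.

(** * Interlacing rows and summation *)

(** All rows x with y_q <= x_q < y_{q + 1}. *)
Fixpoint interlacing (y : seq nat) : seq (seq nat) :=
  if y is a :: y' then
    if y' is b :: _ then [seq i :: r | i <- iota a (b - a), r <- interlacing y'] else [::
      [::]]
  else [:: [::]].

(** The product of the successive differences of E along the sequence a :: y. *)
Fixpoint diff_wedges (R : comPzRingType) (E : nat -> nat ->
  R) a (y : seq nat) (f : bitseq -> R) :=
  if y is b :: y' then wedge (E b - E a) (diff_wedges E b y' f) else f.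

(** The entries of an interlacing row range independently over intervals, so by
    multilinearity each vector is replaced by its sum over an interval, which is
    a difference of partial sums. *)
Lemma sum_wedges_interlacing (R : comPzRingType) (e : nat -> nat -> R) a y f :
  path leq a y ->
  \sum_(x <- interlacing (a :: y)) wedges e x f
  = diff_wedges (fun b => \sum_(0 <= s < b) e s) a y f.
Proof.
elim: y a => [|b y IH] a; first by rewrite /= big_seq1.
move=> /= /andP[ab py]; rewrite big_allpairs_dep -[in RHS]IH //.
rewrite [X in wedge X _](_ : _ = \sum_(a <= s < b) e s); last first.
  by rewrite (big_cat_nat (leq0n a) ab) addrC addKr.
have wedge_suml r (h : nat -> nat ->
  R) g : \sum_(s <- r) wedge (h s) g = wedge (\sum_(s <- r) h s) g.
  elim: r => [|s r IHr]; last by rewrite !big_cons wedgeDl IHr.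
  by rewrite !big_nil; have := wedgeDl (0 : nat -> R) 0 g;
    rewrite addr0 => /(congr1 (fun t => t - wedge 0 g)); rewrite subrr addrK.
rewrite /index_iota -wedge_suml; apply: eq_bigr => i _.
by rewrite raddf_sum.
Qed.

(** e_a e_b = e_a (e_b - e_a): the column operations on a determinant. *)
Lemma wedges_diff (R : comPzRingType) (h : nat -> nat -> R) a y f :
  wedges h (a :: y) f = wedge (h a) (diff_wedges h a y f).
Proof.
elim: y a => //= b y IH a; rewrite [wedge (h b) _]IH wedgeDl wedgeNl raddfB /=.
by rewrite wedge_wedge subr0.
Qed.

(** The number of chains of interlacing rows from y, of size m + 1, up to the row
    [:: k] of size 1. *)
Fixpoint count_rows (k m : nat) (y : seq nat) : nat :=
  if m is m'.+1 then (\sum_(x <- interlacing y) count_rows k m' x)%N else (y == [:: k]).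

Lemma count_rowsS k m y : count_rows k m.+1 y =
  (\sum_(x <- interlacing y) count_rows k m x)%N.
Proof. reflexivity. Qed.

(** The m-fold partial sum of the indicator function of k. *)
Definition apex (k m y : nat) : nat :=
  if m is m'.+1 then if (k < y)%N then 'C(y - k.+1, m') else 0%N else (y == k).

(** At each level the coordinates are replaced by their partial sums and a new
    coordinate 1 is put in front: from the indicator of k one gets in m steps
    1, y, C(y, 2), ..., C(y, m - 1) and the m-fold partial sum of the indicator. *)
Definition level_vector (R : pzSemiRingType) (k m y i : nat) : R :=
  (if (i < m)%N then 'C(y, i) else apex k m y)%:R.

Lemma sum_bin (y i : nat) : (\sum_(0 <= s < y) 'C(s, i) = 'C(y, i.+1))%N.
Proof.
by elim: y => [|y IH]; [rewrite big_geq | rewrite big_nat_recr //= IH binS addnC].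
Qed.

Lemma sum_apex (k m y : nat) : (\sum_(0 <= s < y) apex k m s = apex k m.+1 y)%N.
Proof.
elim: y => [|y IH]; first by rewrite big_geq.
rewrite big_nat_recr //= {}IH; case: m => [|m] /=; first by rewrite !bin0 ltnS;
  case: ltngtP.
case: (ltngtP k y) => [ky|ky|->]; rewrite ?ltnS ?(ltnW ky) ?leqnn ?subSS.
- by rewrite -[(y - k)%N]prednK ?subn_gt0 // -subnS binS addnC.
- by rewrite leqNgt ky.
- by rewrite subnn.
Qed.

Lemma level_vector_succ (R : pzSemiRingType) (k m y : nat) :
  level_vector R k m.+1 y \o succn = \sum_(0 <= s < y) level_vector R k m s.
Proof.
apply/funext => i; rewrite fct_sumE /= /level_vector ltnS -natr_sum.
by case: ifP => im; congr _%:R; rewrite ?sum_bin ?sum_apex.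
Qed.

Lemma diff_wedges_false (R : comPzRingType) (h E : nat -> nat -> R) a y :
  (forall s, h s \o succn = E s) ->
  diff_wedges h a y (@ext_unit R) \o cons false = diff_wedges E a y (@ext_unit R).
Proof.
move=> hE; elim: y a => //= b y IH a; rewrite wedge_cons IH /=.
rewrite [(h b - h a) \o succn](_ : _ = E b - E a); last by rewrite -!hE.
by apply/funext => bs; rewrite fctE /=; ring.
Qed.

(** The new coordinate 1 disappears from differences, so it occurs only in the
    first factor of [wedges_diff]. *)
Lemma diff_wedges_true (R : comPzRingType) (h : nat -> nat -> R) a y :
  (forall s, h s 0%N = 1) ->
  diff_wedges h a y (@ext_unit R) \o cons true = 0.
Proof.
move=> h1; elim: y a => [|b y IH] a /=; first by apply/funext => bs.
rewrite wedge_cons IH raddf0 [(h b - h a) 0%N](_ : _ = h b 0%N - h a 0%N) // !h1 subrr.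
by apply/funext => bs; rewrite fctE /= mulr0 mul0r add0r; apply: mulr0.
Qed.

Lemma mem_interlacing_cons a b y x : (x \in interlacing [:: a, b & y]) =
  if x is i :: x' then (a <= i < b)%N && (x' \in interlacing (b :: y)) else false.
Proof.
rewrite [interlacing _]/=; case: x => [|i x]; apply/idP/idP => //.
- by apply/negP => /allpairsPdep[i [r [_ _]]].
- move=> /allpairsPdep[i' [r [hi hr [-> ->]]]]; rewrite hr andbT.
  by move: hi; rewrite mem_iota; lia.
move=> /andP[hi hx]; apply/allpairsPdep; exists i, x.
by rewrite mem_iota; split=> //; lia.
Qed.

Lemma interlacing_uniq y : uniq (interlacing y).
Proof.
elim: y => // a [|b y] IH //.
apply: allpairs_uniq_dep; first exact: iota_uniq; first by move=> *; exact: IH.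
by move=> [i r] [i' r'] /= _ _ [-> ->].
Qed.

Lemma mem_interlacing x a y : reflect
  (size x = size y /\ forall q, (q < size y)%N ->
    (nth 0 (a :: y) q <= nth 0 x q < nth 0 y q)%N)
  (x \in interlacing (a :: y)).
Proof.
elim: y a x => [|b y IH] a x.
  by rewrite inE; apply: (iffP eqP) => [->|[/size0nil ->]].
rewrite mem_interlacing_cons; case: x => [|i x]; first by constructor; case.
apply: (iffP andP) => [[ai /IH[sz xq]]|[[sz] xq]].
  by split=> [|[|q] hq] //=; rewrite ?sz //; apply: xq.
split; first by have := xq 0%N isT.
by apply/IH; split=> // q hq; apply: (xq q.+1).
Qed.

(** Since x_q < y_{q + 1} <= x_{q + 1}. *)
Lemma interlacing_sorted x a y : path ltn a y -> x \in interlacing (a :: y) ->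
  sorted ltn x /\ size x = size y.
Proof.
elim: y a x => [|b y IH] a x; first by rewrite inE => _ /eqP ->.
rewrite mem_interlacing_cons; case: x => // i x /= /andP[ab py] /andP[ai xy].
have [sx ->] := IH _ _ py xy; split=> //.
case: x sx xy => //= j x sx xy; rewrite sx andbT.
by case: y {IH py} xy => // c y; rewrite mem_interlacing_cons; lia.
Qed.

(** A determinant formula by induction on the number of rows.  Summation over the
    interlacing rows gives the product of the differences of the partial sums of
    the old vectors; these are also the differences of the new vectors, and the
    first new vector contributes only through its coordinate 1. *)
Lemma count_rows_wedges (R : comPzRingType) k m y : sorted ltn y -> size y = m.+1 ->
  (count_rows k m y)%:R = wedges (level_vector R k m) y (@ext_unit R) (nseq m.+1 true).
Proof.
elim: m y => [|m IH] [//|a y] sy [sz].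
  by case: y sz {sy} => // _;
    rewrite /= /level_vector /ext_unit /= mul1r mulr1 mulr0 addr0 eqseq_cons andbT.
rewrite wedges_diff count_rowsS natr_sum [nseq _ _]/= -/(nseq m.+1 true) wedgeE.
have lev1 s : level_vector R k m.+1 s 0%N = 1 by rewrite /level_vector bin0.
rewrite diff_wedges_true // raddf0 lev1 [X in _ + _ * X](_ : _ = 0) // mulr0 addr0 !mul1r.
rewrite -[X in _ = X]/((_ \o cons false) (nseq m.+1 true)).
rewrite (diff_wedges_false _ _ (level_vector_succ R k m)) -sum_wedges_interlacing
  ?fct_sumE; last first.
  by apply: sub_path sy => u v; exact: ltnW.
apply: eq_big_seq => x xy.
by have [sx szx] := interlacing_sorted sy xy; rewrite IH // szx.
Qed.

(** * Summation over the longest row *)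

Lemma mem_subseqs y a L : (y \in subseqs (iota a L)) =
  sorted ltn y && all (fun s => a <= s < a + L)%N y.
Proof.
elim: L a y => [|L IH] a y.
  rewrite inE; case: y => // s y; apply/esym/negbTE; apply/negP => /and3P[_ /= h _]; lia.
rewrite [subseqs _]/= mem_cat IH; apply/orP/andP.
  case=> [/andP[sy ay]|/mapP[z]]; first by split=> //; apply: sub_all ay => s; lia.
  rewrite IH => /andP[sz az] ->; split.
    rewrite /= path_min_sorted //; apply: sub_all az => s /=; lia.
  by rewrite /= leqnn addnS ltnS leq_addr; apply: sub_all az => s; lia.
case: y => [[_ _]|s y [sy /andP[hs ay]]]; first by left.
have := hs; rewrite leq_eqVlt => /andP[/orP[/eqP as_|as_] hs2].
  right; apply/mapP; exists y; last by rewrite as_.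
  rewrite IH (path_sorted sy) /=; apply/allP => t ty.
  by have := allP ay _ ty; have := allP (order_path_min ltn_trans sy) _ ty => /=; lia.
left; rewrite sy /= as_ /= addSn -addnS hs2 /=; apply/allP => t ty.
by have := allP ay _ ty; have := allP (order_path_min ltn_trans sy) _ ty => /=; lia.
Qed.

Lemma subseqs_uniq a L : uniq (subseqs (iota a L)).
Proof.
elim: L a => // L IH a; rewrite [subseqs _]/= cat_uniq IH map_inj_uniq ?IH;
  last by move=> ? ? [].
rewrite andbT /=; apply/hasPn => y /mapP[z _ ->]; rewrite mem_subseqs /=.
by rewrite ltnn andbF.
Qed.

(** A longest row is a subset of [0, N), with m + 1 elements. *)
Definition count_arrays (m N k : nat) : nat :=
  (\sum_(y <- subseqs (iota 0 N) | size y == m.+1) count_rows k m y)%N.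

(** In top degree m + 1 only the subsets with m + 1 elements contribute, so the
    sum over the subsets of that size is a coefficient of the whole ordered
    product. *)
Lemma count_arrays_oprod (R : comPzRingType) m N k :
  (count_arrays m N k)%:R =
    oprod (level_vector R k m) (iota 0 N) (@ext_unit R) (nseq m.+1 true).
Proof.
rewrite -sum_subseqs fct_sumE natr_sum [RHS](bigID (fun y => size y == m.+1)) /=.
rewrite [X in _ = _ + X]big1 ?addr0 => [|y szy]; last first.
  by apply: wedges_homog;
    rewrite -[true :: nseq m true]/(nseq m.+1 true) count_nseq /= mul1n eq_sym.
rewrite big_seq_cond [RHS]big_seq_cond; apply: eq_bigr => y /andP[].
by rewrite mem_subseqs => /andP[sy _] /eqP szy; rewrite count_rows_wedges.
Qed.

Definition bin_vector (R : pzSemiRingType) (s i : nat) : R := 'C(s, i)%:R.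

(** The sign of the degree; it records the passage of a generator through a
    product. *)
Definition parity (R : comPzRingType) (f : bitseq -> R) : bitseq -> R :=
  fun bs => (-1) ^+ count id bs * f bs.

Lemma wedge_parity (R : comPzRingType) (e : nat -> R) f :
  parity (wedge e f) = - wedge e (parity f).
Proof.
apply/funext => bs; rewrite ![in RHS]fctE /parity.
elim: bs e f => [|b bs IH] e f; first by rewrite /=; ring.
rewrite !wedgeE [parity f \o cons b](_ : _ = (-1) ^+ b \*o parity (f \o cons b)).
  rewrite wedgeZ /= -[wedge (e \o succn) (parity _) bs]opprK -IH /=.
  by rewrite exprD; case: b; rewrite /=; ring.
by apply/funext => bs'; rewrite /parity /= exprD mulrA.
Qed.

Lemma oprod_parity (R : comPzRingType) (e : nat -> nat -> R) l :
  parity (oprod e l (@ext_unit R)) = oprod (- e) l (@ext_unit R).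
Proof.
have parityD (f g : bitseq -> R) : parity (f + g) = parity f + parity g.
  by apply/funext => bs; rewrite /parity ![in LHS]fctE mulrDr.
elim: l => [|s l IH] /=; last by rewrite parityD wedge_parity IH wedgeNl.
apply/funext => bs; rewrite /parity /ext_unit.
by case: eqP => [->|_]; rewrite ?mul1r ?mulr0.
Qed.

(** Laplace expansion of all summands of an ordered product along the last
    coordinate, numbered m.  The generator g_m appears once, in the factor of some
    y; it is moved to the right through the later factors, which changes their
    1 + e_s to 1 - e_s. *)
Lemma oprod_laplace (R : comPzRingType) (e h : nat -> nat -> R) m a L bs :
  (forall s i, (i < m)%N -> h s i = e s i) -> size bs = m ->
  oprod h (iota a L) (@ext_unit R) (rcons bs true) =
  \sum_(y < L) h (a + y)%N m *
     oprod e (iota a y) (oprod (- e) (iota (a + y).+1 (L - y.+1)) (@ext_unit R)) bs.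
Proof.
move=> he; elim: L a bs => [|L IH] a bs sz /=.
  by rewrite big_ord0 /ext_unit -cats1 count_cat addn1.
rewrite ![in LHS]fctE IH // wedge_rcons mul1r big_ord_recl /= addn0 subSS subn0.
rewrite sz.
have -> : oprod h (iota a.+1 L) (@ext_unit R) (rcons bs false) =
  oprod e (iota a.+1 L) (@ext_unit R) bs.
  elim: L {IH} bs sz (a.+1) => [|L IHL] bs sz b /=.
    by rewrite /ext_unit -cats1 count_cat addn0.
  rewrite ![in LHS]fctE ![in RHS]fctE IHL // wedge_rcons mul0r addr0; congr (_ + _).
  apply: eq_wedge => [i ib|bs' szb]; first by rewrite he // -sz.
  by rewrite /= IHL // szb.
rewrite mulrAC -[(-1) ^+ _ * _]/(parity _ bs) oprod_parity.
rewrite [_ * h a m]mulrC addrA [LHS]addrC; congr (_ + _).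
pose F y := oprod e (iota a.+1 y)
  (oprod (- e) (iota (a.+1 + y).+1 (L - y.+1)) (@ext_unit R)).
rewrite (@eq_wedge _ _ (e a) _ (\sum_(y < L) h (a.+1 + y)%N m \*o F y)).
- rewrite raddf_sum fct_sumE -big_split; apply: eq_bigr => y _ /=.
  by rewrite wedgeZ [in RHS]/bump /= !add1n !addnS subSS ![in RHS]fctE mulrDr add0n.
- by move=> i ib; rewrite he // -sz.
by move=> bs' szb; rewrite /= IH ?szb // fct_sumE.
Qed.

(** The signed sum of the Vandermonde-type determinants of the m-subsets of [0, N)
    without y, with one sign for each element above y. *)
Definition weight (R : comPzRingType) (m N y : nat) : R :=
  oprod (@bin_vector R) (iota 0 y)
    (oprod (- @bin_vector R) (iota y.+1 (N - y.+1)) (@ext_unit R)) (nseq m true).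

Lemma count_arrays_weight (R : comPzRingType) m N k :
  (count_arrays m N k)%:R = \sum_(y < N) (apex k m y)%:R * weight R m N y.
Proof.
rewrite count_arrays_oprod (_ : nseq m.+1 true = rcons (nseq m true) true); last first.
  by elim: m => //= m ->.
rewrite (oprod_laplace (e := @bin_vector R) (m := m)) ?size_nseq //.
  by apply: eq_bigr => y _; rewrite add0n /level_vector ltnn.
by move=> s i im; rewrite /level_vector im.
Qed.

Lemma contract_unit (R : comPzRingType) j bs : contract j (@ext_unit R) bs = 0.
Proof.
have vac_has bs' : has id bs' -> @ext_unit R bs' = 0
  by rewrite has_count /ext_unit; case: count.
elim: bs j (@ext_unit R) vac_has => [|b bs IH] [|j] f hf //=; first by rewrite hf // mulr0.
by rewrite IH ?mulr0 // => bs' hbs' /=; apply: hf; rewrite /= hbs' orbT.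
Qed.

(** The sum is the top coefficient of an ordered product X of vectors whose i-th
    and m-th coordinates agree.  The difference of the interior products by these
    two coordinates anticommutes with such vectors, hence kills X. Read at the
    monomial without g_i, this says that the top coefficient vanishes, because
    the interior product by g_m has no monomial containing g_m. *)
Lemma weight_ortho (R : comPzRingType) m N i : (i < m)%N ->
  \sum_(y < N) 'C(y, i)%:R * weight R m N y = 0.
Proof.
move=> im; pose h s j : R := 'C(s, if j == m then i else j)%:R.
pose X := oprod h (iota 0 N) (@ext_unit R).
have <- : X (rcons (nseq m true) true) = \sum_(y < N) 'C(y, i)%:R * weight R m N y.
  rewrite /X (oprod_laplace (e := @bin_vector R) (m := m)) ?size_nseq //.
    by apply: eq_bigr => y _; rewrite add0n /h eqxx.
  by move=> s j jm; rewrite /h ltn_eqF.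
have kill l bs : size bs = m.+1 ->
    contract i (oprod h l (@ext_unit R)) bs = contract m (oprod h l (@ext_unit R)) bs.
  elim: l bs => [|s l IH] bs sz /=.
    by rewrite !contract_unit.
  rewrite !contractD ![in LHS]fctE ![in RHS]fctE IH //; congr (_ + _).
  apply: (addIr (wedge (h s) (contract m (oprod h l (@ext_unit R))) bs)).
  rewrite contract_wedge ?sz //
    -(@eq_wedge _ (h s) _ (contract i (oprod h l (@ext_unit R)))) //.
    by rewrite contract_wedge ?sz 1?ltnW // /h eqxx ltn_eqF.
  by move=> bs' szb; rewrite IH // szb.
pose p := nseq i true ++ false :: nseq (m - i.+1) true.
have szp : size p = m by rewrite size_cat /= !size_nseq; lia.
have := kill (iota 0 N) (p ++ [:: true]); rewrite size_cat szp addn1 => /(_ erefl).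
have := contract_cat X p true [::]; rewrite szp !mul0r -/X => ->.
have := contract_cat X (nseq i true) false (nseq (m - i.+1) true ++ [:: true]).
rewrite size_nseq mul1r -catA => -> /(congr1 ( *%R ((-1) ^+ i))).
rewrite mulr0 count_nseq mul1n mulrA -exprD addnn -mul2n exprM sqrrN expr1n expr1n mul1r
  => <-.
congr X; rewrite -cats1 -[true :: nseq _ true ++ _]cat1s !catA; congr (_ ++ _).
by rewrite -[[:: true]]/(nseq 1 true) -!nseqD; congr nseq; lia.
Qed.

(** * The weight is a polynomial *)

(** Between y and y + 1 the two products differ only in the middle, where
    (1 + e_y) - (1 - e_{y + 1}) = e_y + e_{y + 1}.  Moved to the left, this vector
    turns all the 1 + e_s into 1 - e_s and absorbs the two missing factors. *)
Lemma weight_succ (R : comPzRingType) m N y : (y.+1 < N)%N ->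
  weight R m N y.+1 - weight R m N y =
  wedge (@bin_vector R y + @bin_vector R y.+1)
    (oprod (- @bin_vector R) (iota 0 N) (@ext_unit R)) (nseq m true).
Proof.
move=> yN; set e := @bin_vector R;
  set r := oprod (- e) (iota y.+2 (N - y.+2)) (@ext_unit R).
have -> : oprod (- e) (iota 0 N) (@ext_unit R) =
  oprod (- e) (iota 0 y) (oprod (- e) [:: y; y.+1] r).
  rewrite /r -!oprod_cat; congr oprod.
  have {1}-> : N = (y + (2 + (N - y.+2)))%N by lia.
  by rewrite !iotaD add0n addn2 catA.
rewrite -oprod_wedge wedge_oprod2 /weight -/e.
rewrite (_ : iota 0 y.+1 = iota 0 y ++ [:: y]); last by rewrite -addn1 iotaD add0n.
rewrite (_ : (N - y.+1 = (N - y.+2).+1)%N) ?[iota y.+1 _.+1]/=; last by lia.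
rewrite oprod_cat -/r.
rewrite -[LHS]/((oprod e (iota 0 y) (oprod e [:: y] r) -
  oprod e (iota 0 y) (oprod (- e) (y.+1 :: iota y.+2 (N - y.+2)) (@ext_unit R)))
    (nseq m true)).
rewrite -oprodB; congr (oprod _ _ _ _).
rewrite /= -/r [(- e) _](_ : _ = - e y.+1) // wedgeNl wedgeDl.
by rewrite opprB [r + _]addrC addrACA subrr addr0.
Qed.

(** The differences of the weight are fixed combinations of the
    C(y, i) + C(y + 1, i), i < m, so the weight is a combination of the C(y, i),
    i <= m. *)
Lemma weight_newton (R : comPzRingType) m N :
  exists b : nat -> R, forall y, (y < N)%N ->
    weight R m N y = \sum_(i < m.+1) b i * 'C(y, i)%:R.
Proof.
pose c i := wedge (fun j => (j == i)%:R)
  (oprod (- @bin_vector R) (iota 0 N) (@ext_unit R)) (nseq m true).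
have cm : c m = 0.
  rewrite /c wedge_scalar big1 // => i _; rewrite size_nseq in i *.
  by rewrite (ltn_eqF (ltn_ord i)) mul0r.
(* From C(y + 1, i) = C(y, i) + C(y, i - 1); the term c m in the last one is zero. *)
exists (fun i => if i is j.+1 then 2 * c j + c j.+1 else weight R m N 0) => y.
elim: y => [|y IH] yN.
  by rewrite big_ord_recl /= mulr1 big1 ?addr0 // => i _; rewrite bin0n mulr0.
have /eqP := weight_succ R m yN; rewrite subr_eq => /eqP ->.
rewrite (IH (ltnW yN)) wedge_scalar size_nseq {IH}.
rewrite !big_ord_recl /= !bin0 addrCA; congr (_ + _).
rewrite [RHS](eq_bigr (fun i : 'I_m => (2 * c i + c i.+1) * 'C(y, i.+1)%:R +
  (2 * c i + c i.+1) * 'C(y, i)%:R)); last first.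
  by move=> i _; rewrite /bump /= add1n binS natrD mulrDr.
rewrite big_split /= addrC; congr (_ + _).
have shift (g : nat -> R) : \sum_(i < m) c i.+1 * g i.+1 =
  \sum_(i < m) c i * g i - c 0%N * g 0%N.
  have : \sum_(i < m.+1) c i * g i =
    \sum_(i < m) c i * g i by rewrite big_ord_recr /= cm mul0r addr0.
  by rewrite big_ord_recl /= => <-; rewrite addrC addKr.
have := shift (fun j => 'C(y.+1, j)%:R - 'C(y, j)%:R).
rewrite !bin0 subrr mulr0 subr0 => shift_bin.
rewrite [RHS](eq_bigr (fun i : 'I_m => 2 * c i * 'C(y, i)%:R +
  c i.+1 * ('C(y.+1, i.+1)%:R - 'C(y, i.+1)%:R))).
  rewrite big_split /= shift_bin -big_split /=; apply: eq_bigr => i _.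
  by rewrite -/(c i) [(bin_vector R y + _) _](_ : _ = 'C(y, i)%:R + 'C(y.+1, i)%:R) //;
    ring.
by move=> i _; rewrite binS natrD; ring.
Qed.

(** * Polynomials with prescribed roots *)

Lemma bin_convolution k i a :
  (\sum_(y < k.+1) 'C(y, i) * 'C(k - y + a, a) = 'C(k + a.+1, i + a.+1))%N.
Proof.
elim: a k => [|a IHa] k.
  rewrite (eq_bigr (fun y : 'I_k.+1 => 'C(y, i))) => [|y _]; last by rewrite bin0 muln1.
  by rewrite -(big_mkord xpredT (fun y => 'C(y, i))) sum_bin !addn1.
elim: k => [|k IHk].
  rewrite big_ord_recl big_ord0 /= subnn add0n binn muln1 addn0 bin0n add0n.
  case: (posnP i) => [->|i0]; first by rewrite add0n binn.
  by rewrite bin_small //; lia.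
rewrite big_ord_recr /= subnn add0n binn muln1.
rewrite (eq_bigr (fun y : 'I_k.+1 => 'C(y, i) * 'C(k.+1 - y + a, a) +
                                     'C(y, i) * 'C(k - y + a.+1, a.+1))%N); last first.
  move=> y _; rewrite -mulnDr; congr (_ * _)%N.
  have -> : (k.+1 - y + a.+1 = (k - y + a.+1).+1)%N by have := ltn_ord y; lia.
  by rewrite binS addnC; congr ('C(_, _) + _)%N; have := ltn_ord y; lia.
rewrite big_split /= IHk addnAC.
have := IHa k.+1; rewrite big_ord_recr /= subnn add0n binn muln1 => ->.
have -> : (k.+1 + a.+1 = k + a.+2)%N by lia.
have -> : (k.+1 + a.+2 = (k + a.+2).+1)%N by lia.
by rewrite [(i + a.+2)%N]addnS binS addnC.
Qed.

Definition bin_poly (i : nat) : {poly rat} :=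
  (i`!%:R)^-1 *: \prod_(j < i) ('X - j%:R%:P).

Lemma size_bin_poly i : size (bin_poly i) = i.+1.
Proof.
rewrite size_scale ?size_prod_XsubC ?/index_enum -?enumT ?size_enum_ord //.
by rewrite invr_eq0 pnatr_eq0 -lt0n fact_gt0.
Qed.

Lemma bin_poly_nat i s : (bin_poly i).[s%:R] = 'C(s, i)%:R.
Proof.
have f0 : i`!%:R != 0 :> rat by rewrite pnatr_eq0 -lt0n fact_gt0.
apply: (mulfI f0); rewrite hornerZ mulrA divff // mul1r horner_prod -natrM mulnC bin_ffact.
elim: i s {f0} => [|i IH] s; first by rewrite big_ord0 ffactn0.
rewrite big_ord_recr /= IH ffactnSr natrM !hornerE.
have [si|is_] := ltnP s i; first by rewrite ffact_small // !mul0r.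
by rewrite natrB.
Qed.

(** Upper negation. *)
Lemma bin_poly_neg i s : (bin_poly i).[- s.+1%:R] = (-1) ^+ i * 'C(s + i, i)%:R.
Proof.
have f0 : i`!%:R != 0 :> rat by rewrite pnatr_eq0 -lt0n fact_gt0.
apply: (mulfI f0); rewrite hornerZ mulrA divff // mul1r horner_prod mulrCA -natrM mulnC
  bin_ffact.
elim: i {f0} => [|i IH]; first by rewrite big_ord0 ffactn0 mul1r.
rewrite big_ord_recr /= IH addnS ffactnS /= !hornerE exprS natrM.
rewrite -[_.+1%:R]natr1 -addn1 !natrD; ring.
Qed.

Lemma newton_expansion (p : {poly rat}) m : (size p <= m)%N ->
  exists a : nat -> rat, forall y : nat, p.[y%:R] = \sum_(i < m) a i * 'C(y, i)%:R.
Proof.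
elim: m p => [|m IH] p sp.
  exists (fun=> 0) => y; move: sp; rewrite leqn0 size_poly_eq0 => /eqP ->.
  by rewrite horner0 big_ord0.
have lm : (bin_poly m)`_m != 0.
  by rewrite -[X in _`_X]/(m.+1.-1) -[in X in _`_X](size_bin_poly m) -/(lead_coef _)
    lead_coef_eq0 -size_poly_eq0 size_bin_poly.
have [|a ap] := IH (p - (p`_m / (bin_poly m)`_m) *: bin_poly m).
  apply/leq_sizeP => j; rewrite leq_eqVlt coefB coefZ => /orP[/eqP <-|mj].
    by rewrite divfK // subrr.
  by rewrite (nth_default _ (leq_trans sp mj)) [(bin_poly m)`_j]nth_default
    ?size_bin_poly // mulr0 subr0.
exists (fun i => if i == m then p`_m / (bin_poly m)`_m else a i) => y.
rewrite big_ord_recr /= eqxx -bin_poly_nat.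
have := ap y; rewrite hornerD hornerN hornerZ => /eqP; rewrite subr_eq => /eqP ->.
by congr (_ + _); apply: eq_bigr => i _; rewrite ltn_eqF.
Qed.

Lemma weight_ortho_poly (p : {poly rat}) m N : (size p <= m)%N ->
  \sum_(y < N) p.[y%:R] * weight rat m N y = 0.
Proof.
move=> /newton_expansion[a ap].
rewrite (eq_bigr (fun y : 'I_N => \sum_(i < m) a i * ('C(y, i)%:R * weight rat m N y))).
  rewrite exchange_big big1 //= => i _.
  by rewrite -mulr_sumr weight_ortho ?mulr0.
by move=> y _; rewrite ap mulr_suml; apply: eq_bigr => i _; rewrite mulrA.
Qed.

(** For y > k the function apex k is the polynomial C(y - k - 1, m), of degree m,
    against which the weight sums to zero; so the sum over y > k is minus the sum
    over y <= k, where that polynomial is (-1)^m C(k - y + m, m). *)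
Lemma count_arrays_head m N k : (k < N)%N ->
  (count_arrays m.+1 N k)%:R = (-1) ^+ m.+1 *
     \sum_(y < k.+1) weight rat m.+1 N y * 'C(k - y + m, m)%:R.
Proof.
move=> kN; rewrite (count_arrays_weight rat).
pose p := bin_poly m \Po ('X - k.+1%:R%:P).
have sp : (size p <= m.+1)%N.
  by rewrite size_comp_poly2 ?size_XsubC ?size_bin_poly.
have pE y : p.[y%:R] = if (k < y)%N then 'C(y - k.+1, m)%:R
    else (-1) ^+ m * 'C(k - y + m, m)%:R.
  rewrite horner_comp hornerXsubC; case: ltnP => ky;
    first by rewrite -natrB // bin_poly_nat.
  by rewrite -[y%:R - _]opprB -natrB ?leqW // subSn // bin_poly_neg.
rewrite -[LHS]subr0 -[X in _ - X](weight_ortho_poly N sp) -sumrB.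
rewrite (eq_bigr (fun y : 'I_N =>
  (if (y < k.+1)%N then (-1) ^+ m.+1 * (weight rat m.+1 N y * 'C(k - y + m, m)%:R)
   else 0))).
  by rewrite -big_mkcond -(big_ord_widen _ (fun y =>
    (-1) ^+ m.+1 * (weight rat m.+1 N y * 'C(k - y + m, m)%:R))) ?mulr_sumr.
by move=> y _; rewrite pE /= ltnS; case: ltnP => _; rewrite ?subrr // exprS; ring.
Qed.

(** The apex is at most the last entry of the longest row, which is at most c; in
    terms of the weight, all the coefficients of the sum vanish. *)
Lemma count_arrays_gt m c k : (c < k < c + m.+2)%N -> count_arrays m.+1 (c + m.+2) k = 0%N.
Proof.
move=> ck; apply/eqP; rewrite -(eqr_nat rat) (count_arrays_weight rat) big1 // => y _.
rewrite /=; case: ifP => ky; last by rewrite mul0r.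
by rewrite bin_small ?mul0r //; have := ltn_ord y; lia.
Qed.

Lemma count_arrays0 c k : (k <= c)%N -> (count_arrays 0 (c + 1) k)%:R = 1 :> rat.
Proof.
move=> kc; have kc1 : (k < c + 1)%N by lia.
rewrite (count_arrays_weight rat) (bigD1 (Ordinal kc1)) //= eqxx big1 ?addr0 => [|y];
  last first.
  by rewrite -val_eqE /= => /negbTE ->; rewrite mul0r.
have oprod_nil (e : nat -> nat -> rat) l f : oprod e l f [::] = f [::].
  by elim: l => //= s l IH; rewrite fctE IH /= addr0.
by rewrite /weight !oprod_nil mulr1.
Qed.

(** By [count_arrays_head] and [weight_newton] the count is, up to sign, the value
    at k + m + 1 of a combination q of the C(X, i + m + 1), i <= m + 1. The degree
    of q is at most 2 m + 2.  It vanishes at 0, ..., m, like these binomials, and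
    at N, ..., N + m by [count_arrays_gt]; so q is determined up to a factor. *)
Lemma count_arrays_product m c : exists t : rat, forall k, (k <= c)%N ->
  (count_arrays m.+1 (c + m.+2) k)%:R =
    t * (pochhammer (1 + k%:R) m.+1 * pochhammer (1 + c%:R - k%:R) m.+1).
Proof.
set N := (c + m.+2)%N.
have [b bw] := weight_newton rat m.+1 N.
pose q : {poly rat} := \sum_(i < m.+2) b i *: bin_poly (i + m.+1).
have qtot k : (k < N)%N -> (count_arrays m.+1 N k)%:R = (-1) ^+ m.+1 * q.[(k + m.+1)%:R].
  move=> kN; rewrite count_arrays_head //; congr (_ * _).
  rewrite (eq_bigr (fun y : 'I_k.+1 =>
    \sum_(i < m.+2) b i * ('C(y, i)%:R * 'C(k - y + m, m)%:R))).
    rewrite exchange_big horner_sum /=; apply: eq_bigr => i _.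
    rewrite -mulr_sumr hornerZ bin_poly_nat -bin_convolution natr_sum; congr (_ * _).
    by apply: eq_bigr => y _; rewrite natrM.
  move=> y _; rewrite bw ?mulr_suml; last by have := ltn_ord y; lia.
  by apply: eq_bigr => i _; rewrite mulrA.
have q_low j : (j < m.+1)%N -> q.[j%:R] = 0.
  move=> jm; rewrite horner_sum big1 // => i _.
  by rewrite hornerZ bin_poly_nat bin_small ?mulr0 //; lia.
have q_high j : (j < m.+1)%N -> q.[(N + j)%:R] = 0.
  move=> jm; have := qtot (c.+1 + j)%N; rewrite count_arrays_gt /N; last by lia.
  move=> /(_ ltac:(lia)) /esym/eqP; rewrite mulf_eq0 signr_eq0 /=.
  by rewrite (_ : (c.+1 + j + m.+1 = c + m.+2 + j)%N) => [/eqP|]; last lia.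
pose rs : seq rat := [seq j%:R | j <- iota 0 m.+1 ++ iota N m.+1].
have rs_root : all (root q) rs.
  rewrite all_map all_cat; apply/andP; split; apply/allP => j; rewrite mem_iota => hj;
    apply/eqP.
    by apply: q_low; lia.
  by rewrite -(subnKC (_ : N <= j)%N) ?q_high //; lia.
have rs_uniq : uniq_roots rs.
  rewrite uniq_rootsE map_inj_uniq; last by move=> ? ? /eqP; rewrite eqr_nat => /eqP.
  rewrite cat_uniq !iota_uniq andbT andTb; apply/hasPn => j; rewrite !mem_iota /N; lia.
have qdvd := uniq_roots_dvdp rs_root rs_uniq.
pose P : {poly rat} := \prod_(z <- rs) ('X - z%:P).
have Pmonic : P \is monic by apply: monic_prod_XsubC.
have sq : (size q <= size P)%N.
  rewrite size_prod_XsubC size_map size_cat !size_iota.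
  apply: leq_trans (size_sum _ _ _) _; apply/bigmax_leqP => i _.
  apply: leq_trans (size_scale_leq _ _) _; rewrite size_bin_poly.
  by have := ltn_ord i; lia.
pose t := (q %/ P)`_0.
have qP : q = t *: P.
  rewrite -{1}(divpK qdvd) -mul_polyC -/P; congr (_ * _); apply: size1_polyC.
  rewrite size_divp ?monic_neq0 // leq_subLR addn1; apply: leq_trans sq _; exact: leqSpred.
exists t => k kc; rewrite qtot; last by rewrite /N; lia.
rewrite qP hornerZ mulrCA; congr (_ * _).
have iotaN : iota N m.+1 =
  [seq (N + j)%N | j <- index_iota 0 m.+1] by rewrite -iotaDl addn0.
rewrite horner_prod big_map iotaN -[iota 0 m.+1]/(index_iota 0 m.+1) /pochhammer.
set I := index_iota 0 m.+1; rewrite big_cat big_map /= mulrCA {}/I; congr (_ * _).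
  rewrite big_nat_rev /=; apply: eq_big_nat => j jm.
  by rewrite hornerXsubC -natrB; [rewrite -[1]/(1%:R) -!natrD; congr _%:R|]; lia.
have -> : (-1) ^+ m.+1 = \prod_(0 <= j < m.+1) (-1 : rat) by rewrite prodr_const_nat subn0.
rewrite -big_split; apply: eq_bigr => j _.
by rewrite /= hornerXsubC /N !natrD -[m.+2%:R]natr1; ring.
Qed.

(** * Counting the elements of a predicate *)

Definition has_card (T : eqType) (P : T -> Prop) (N : nat) :=
  exists s : seq T, [/\ uniq s, size s = N & forall a, a \in s <-> P a].

Lemma has_card_ext (T : eqType) (P Q : T -> Prop) N :
  (forall a, P a <-> Q a) -> has_card P N -> has_card Q N.
Proof. by move=> PQ [s [us ss sP]]; exists s; split=> // a; rewrite sP. Qed.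

Lemma has_card_bigcup (T U : eqType) (X : seq U) (P : U -> T -> Prop) (f : U -> nat) :
  uniq X -> (forall x, x \in X -> has_card (P x) (f x)) ->
  (forall x y a, x \in X -> y \in X -> P x a -> P y a -> x = y) ->
  has_card (fun a => exists2 x, x \in X & P x a) (\sum_(x <- X) f x)%N.
Proof.
elim: X => [_ _ _|x X IH /= /andP[xX uX] cP disj].
  by exists [::]; rewrite big_nil; split=> // a; split=> // -[].
have [||s [us ss sP]] := IH uX.
- by move=> y yX; apply: cP; rewrite inE yX orbT.
- by move=> y z a yX zX; apply: disj; rewrite inE ?yX ?zX orbT.
have [t [ut st tP]] := cP x (mem_head _ _).
exists (t ++ s); rewrite big_cons size_cat ss st; split=> //.
  rewrite cat_uniq ut us andbT; apply/hasPn => a /sP[y yX Pya].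
  by apply/negP => /tP Pxa; move: xX;
    rewrite (disj _ _ _ _ _ Pxa Pya) ?yX ?inE ?eqxx ?yX ?orbT.
move=> a; rewrite mem_cat; split.
  case/orP => [/tP|/sP[y yX]] Pa; first by exists x; rewrite ?mem_head.
  by exists y; rewrite // inE yX orbT.
case=> y; rewrite inE => /orP[/eqP ->|yX] Pa; apply/orP; first by left; apply/tP.
by right; apply/sP; exists y.
Qed.

Lemma has_card_image (T U : eqType) (P : T -> Prop) (g : T -> U) N :
  (forall a b, P a -> P b -> g a = g b -> a = b) ->
  has_card P N -> has_card (fun b => exists2 a, P a & b = g a) N.
Proof.
move=> ginj [s [us ss sP]]; exists (map g s); rewrite size_map map_inj_in_uniq; last first.
  by move=> a b /sP Pa /sP Pb; exact: ginj.
split=> // b; split=> [/mapP[a /sP Pa ->]|[a Pa ->]]; first by exists a.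
by apply/map_f/sP.
Qed.

(** * Patterns without inversions *)

Definition monotone_array (m c k : nat) (a : nat -> nat -> int) : Prop :=
  [/\ forall i j, ~~ gt_index m m.+1 i j -> a i j = 0,
      forall i, (1 <= i <= m.+1)%N -> a i i.-1 = 0 /\ a i m.+2 = c,
      forall i j, (1 <= i <= m)%N -> (i <= j <= m.+1)%N -> a i.+1 j <= a i j <= a i.+1 j.+1
    & a m.+1 m.+1 = k].

(** Weak increase propagates downward from the top row 0 <= k <= c: if a row
    increases, the entries of the next longer row lie between its successive
    entries, the outermost ones between these and the boundary values 0 and c. *)
Lemma row_monotone m c k (a : nat -> nat -> int) : (k <= c)%N ->
  (forall i, (1 <= i <= m.+1)%N -> a i i.-1 = 0 /\ a i m.+2 = c) ->
  a m.+1 m.+1 = k ->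
  (forall i j, (1 <= i <= m)%N -> (i <= j <= m.+1)%N ->
     a i.+1 j <= a i.+1 j.+1 -> a i.+1 j <= a i j <= a i.+1 j.+1) ->
  forall i j, (1 <= i <= m.+1)%N -> (i.-1 <= j <= m.+1)%N -> a i j <= a i j.+1.
Proof.
move=> kc bd ak H i j i1; have [d] : exists d, (i + d = m.+1)%N by exists (m.+1 - i)%N; lia.
elim: d i i1 j => [|d IH] i i1 j id ij; have [a0 ac] := bd i i1.
  rewrite addn0 in id; subst i; have [->|->] : j = m \/ j = m.+1 by lia.
    by rewrite [a m.+1 m]a0 ak.
  by rewrite ac ak lez_nat.
have rowS l : (i <= l <= m.+1)%N -> a i.+1 l <= a i l <= a i.+1 l.+1.
  by move=> il; apply: H; [lia|lia|apply: IH; lia].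
have [b0 bc] := bd i.+1 ltac:(lia).
have [->|ji] := eqVneq j i.-1.
  have -> : a i i.-1 = 0 by [].
  rewrite prednK; last by lia.
  by have := rowS i ltac:(lia); rewrite [a i.+1 i]b0 => /andP[].
have := rowS j ltac:(lia) => /andP[_ h1].
have [jm|jm] := eqVneq j m.+1; first by rewrite jm ac -bc -jm.
by have := rowS j.+1 ltac:(lia) => /andP[h2 _]; exact: le_trans h1 h2.
Qed.

Lemma monotone_array_row m c k a : (k <= c)%N -> monotone_array m c k a ->
  forall i j, (1 <= i <= m.+1)%N -> (i.-1 <= j <= m.+1)%N -> a i j <= a i j.+1.
Proof. by move=> kc [_ bd H ak]; apply: (row_monotone kc bd ak) => i j hi hj _;
  exact: H. Qed.

Lemma gt_patterns_topP m c k a : (k <= c)%N ->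
  gt_patterns_top (r := m) (n := m.+1) c%:Z (fun=> k%:Z) a <-> monotone_array m c k a.
Proof.
move=> kc; split.
  move=> [[a0 bd H1 H2] ak].
  have akk : a m.+1 m.+1 = k.
    have lt1 : (0 < m.+1 - m)%N by rewrite subSnn.
    by have := ak (Ordinal lt1); rewrite /= addn1.
  split=> // i j hi hj; apply: (H1 i.+1 j); [lia|lia|].
  apply: (row_monotone kc bd akk) => [i' j' hi' hj'||]; [|lia|lia].
  by apply: (H1 i'.+1 j'); lia.
move=> tri; have row := monotone_array_row kc tri.
case: tri => a0 bd H ak; split; last first.
  move=> [i hi]; rewrite /= (_ : (m + i.+1 = m.+1)%N) //; lia.
split=> // i j hi hj.
  by move=> _; have := H i.-1 j ltac:(lia) ltac:(lia); rewrite prednK //; lia.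
by rewrite ltNge row; lia.
Qed.

Lemma monotone_array_sgn m c k a : (k <= c)%N -> monotone_array m c k a ->
  gt_sgn m m.+1 a = 1.
Proof.
move=> kc tri; rewrite /gt_sgn /gt_inversions big_nat_cond big1 ?expr0 // => i hi.
rewrite big_nat_cond big1 // => j hj.
by rewrite ltNge (monotone_array_row kc tri) //; lia.
Qed.

Definition has_row m (y : seq nat) (a : nat -> nat -> int) : Prop :=
  forall q, (q <= m)%N -> a 1%N q.+1 = (nth 0%N y q)%:Z - q%:Z.

(** The row with entries y_q - q is put below the array a, all of whose rows move
    up by one and whose columns move by one, so that the boundary column
    a_{i, i - 1} = 0 is preserved. *)
Definition add_row m (c : nat) (y : seq nat) (a : nat -> nat -> int) (i j : nat) : int :=
  match i, j with
  | 1%N, q.+1 => if (q <= m)%N then (nth 0%N y q)%:Z - q%:Z else if q == m.+1 then c%:Z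
    else 0
  | i'.+2, j'.+1 => a i'.+1 j'
  | _, _ => 0
  end.

Lemma add_row_monotone m c k y x a :
  size y = m.+2 -> (last 0 y < c + m.+2)%N -> size x = m.+1 ->
  (forall q, (q < m.+1)%N -> (nth 0 y q <= nth 0 x q < nth 0 y q.+1)%N) ->
  monotone_array m c k a -> has_row m x a ->
  monotone_array m.+1 c k (add_row m.+1 c y a).
Proof.
move=> szy yc szx yx [a0 bd H ak] rx; split.
- move=> [|[|i]] [|j] //; rewrite /gt_index /= => hij; last by apply: a0;
  rewrite /gt_index; lia.
  by rewrite !ifN //; lia.
- move=> [|[|i]] // hi; first by rewrite /= eqxx ltnn.
  by move: hi => /= hi; exact: (bd i.+1 ltac:(lia)).
- move=> [|[|i]] [|j] // hi hj; last by apply: H; lia.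
  rewrite /= ifT; last by lia.
  have [b0 bc] := bd 1%N isT; apply/andP; split.
    case: j hj => [|j] hj; first by rewrite [a 1%N 0%N]b0; lia.
    by rewrite rx; [have := yx j ltac:(lia)|]; lia.
  have [jm|jm] := eqVneq j m.+1.
    by rewrite jm bc; move: yc; rewrite (last_nth 0%N) szy /=; lia.
  by rewrite rx; [have := yx j ltac:(lia)|]; lia.
- exact: ak.
Qed.

Lemma add_row_has_row m c y a : has_row m.+1 y (add_row m.+1 c y a).
Proof. by move=> q qm; rewrite /= qm. Qed.

Lemma del_row_monotone m c k y a : (k <= c)%N ->
  monotone_array m.+1 c k a -> has_row m.+1 y a -> size y = m.+2 ->
  exists2 x, (size x = m.+1 /\ forall q, (q < m.+1)%N ->
    (nth 0 y q <= nth 0 x q < nth 0 y q.+1)%N)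
  & exists2 b, monotone_array m c k b /\ has_row m x b & a = add_row m.+1 c y b.
Proof.
move=> kc tri ry szy; have row := monotone_array_row kc tri.
case: tri => a0 bd H ak.
(* The absolute value changes nothing, as a_{2, q + 2} + q >= y_q. *)
exists (mkseq (fun q => absz (a 2%N q.+2 + q%:Z)) m.+1).
  split; first by rewrite size_mkseq.
  move=> q qm; rewrite nth_mkseq //.
  have := H 1%N q.+1 ltac:(lia) ltac:(lia); have := H 1%N q.+2 ltac:(lia) ltac:(lia).
  by rewrite !ry; lia.
exists (fun i j => if i is _.+1 then a i.+1 j.+1 else 0).
  split; first split.
  - move=> [|i] j // hij; apply: a0; move: hij; rewrite /gt_index; lia.
  - move=> [|i] // hi; have [] := bd i.+2 ltac:(lia); rewrite /= => h ->; split=> //.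
  - by move=> [|i] j // hi hj; apply: (H i.+2 j.+1); lia.
  - by rewrite ak.
  move=> q qm; rewrite nth_mkseq; last by lia.
  have := H 1%N q.+1 ltac:(lia) ltac:(lia); rewrite ry; lia.
apply/funext => -[|[|i]]; apply/funext => -[|j]; rewrite /add_row //.
- by apply: a0.
- by apply: a0.
- by have [] := bd 1%N isT.
- case: leqP => jm; first by rewrite ry.
  case: eqP => [->|jm2]; first by have [] := bd 1%N isT.
  by apply: a0; rewrite /gt_index; lia.
- by apply: a0; rewrite /gt_index; lia.
Qed.

Lemma has_card_arrays_with_row m c k y : (k <= c)%N ->
  sorted ltn y -> size y = m.+1 -> (last 0 y < c + m.+1)%N ->
  has_card (fun a => monotone_array m c k a /\ has_row m y a) (count_rows k m y).
Proof.
move=> kc; elim: m y => [|m IH] y sy szy yc.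
  case: y szy yc {sy} => [//|y0 []] // _ /= yc.
  pose a := add_row 0 c [:: y0] (fun _ _ => 0).
  have ra : has_row 0 [:: y0] a by move=> q q0; rewrite /= q0.
  exists (if y0 == k then [:: a] else [::]).
  rewrite /= eqseq_cons andbT; case: eqP => [y0k|y0k]; split=> // b; last first.
    split=> // -[[_ _ _ bk]] /(_ 0%N isT); rewrite bk /=; lia.
  rewrite inE; split=> [/eqP ->|[[b0 bd _ _] rb]].
    split=> //; split.
    - move=> [|[|i]] [|j] //; rewrite /gt_index /= => hij; by rewrite !ifN //; lia.
    - by case=> [|[|i]].
    - by move=> i j; lia.
    - by rewrite /= y0k; lia.
  apply/eqP/funext => -[|[|i]]; apply/funext => -[|j]; rewrite /a /add_row //.
  - by apply: b0.
  - by apply: b0.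
  - by have [] := bd 1%N isT.
  - case: leqP => j0; first by rewrite rb.
    case: eqP => [->|j1]; first by have [] := bd 1%N isT.
    by apply: b0; rewrite /gt_index; lia.
  - by apply: b0; rewrite /gt_index; lia.
  - by apply: b0; rewrite /gt_index; lia.
rewrite count_rowsS.
case: y sy szy yc => [//|y0 y] sy szy yc.
have szx x : x \in interlacing (y0 :: y) -> size x = m.+1.
  by move=> /(interlacing_sorted sy)[_ ->]; case: szy.
pose P x a := exists2 b, monotone_array m c k b /\ has_row m x b & a =
  add_row m.+1 c (y0 :: y) b.
have addK (b b' : nat -> nat -> int) : b 0%N = b' 0%N ->
  add_row m.+1 c (y0 :: y) b = add_row m.+1 c (y0 :: y) b' -> b = b'.
  move=> e0 e; apply/funext => -[|i] //; apply/funext => j.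
  by have := congr1 (fun h => h i.+2 j.+1) e.
have tri0 b : monotone_array m c k b -> b 0%N = fun=> 0.
  by case=> b0 _ _ _; apply/funext => j; exact: b0.
apply: (@has_card_ext _ (fun a => exists2 x, x \in interlacing (y0 :: y) & P x a)).
  move=> a; split.
    move=> [x xy [b [tb rb] ->]]; split; last exact: add_row_has_row.
    apply: add_row_monotone tb rb => //; first exact: szx.
    by move/mem_interlacing: xy => [_ hx] q qm; apply: hx; case: szy => ->.
  move=> [ta ra]; have [x [sx hx] [b [tb rb] ->]] := del_row_monotone kc ta ra szy.
  exists x; last by exists b.
  by apply/mem_interlacing; case: szy => ->; split=> // q qm; apply: hx.
apply: has_card_bigcup; first exact: interlacing_uniq.
- move=> x xy; apply: has_card_image; last first.
    have [sx _] := interlacing_sorted sy xy; apply: IH => //; first exact: szx.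
    have sz := szx _ xy; rewrite -nth_last sz /=.
    have szy' : size y = m.+1 by case: szy.
    move/mem_interlacing: xy => [_ /(_ m)]; rewrite szy' => /(_ (ltnSn m)) hm.
    by move: yc; rewrite /= (last_nth 0%N) szy' /=; lia.
  by move=> b b' [tb _] [tb' _]; apply: addK; rewrite !tri0.
move=> x x' a xy x'y [b [tb rb] ->] [b' [tb' rb'] /addK bb'].
apply: (@eq_from_nth _ 0%N) => [|q]; rewrite ?szx // => qm.
have := rb q qm; rewrite bb' ?tri0 // rb' //; lia.
Qed.

(** The longest row of an array, shifted to be strictly increasing, is a subset of
    [0, c + m + 1). *)
Lemma has_card_arrays m c k : (k <= c)%N ->
  has_card (monotone_array m c k) (count_arrays m (c + m.+1) k).
Proof.
move=> kc; rewrite /count_arrays -big_filter.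
set X := filter _ _.
have memX y : (y \in X) = [&& size y == m.+1, sorted ltn y & all (fun s =>
  s < c + m.+1)%N y].
  by rewrite mem_filter mem_subseqs add0n.
apply: (@has_card_ext _ (fun a =>
  exists2 y, y \in X & monotone_array m c k a /\ has_row m y a)).
  move=> a; split=> [[y _ []] //|tri]; have row := monotone_array_row kc tri.
  have row0 q : (q <= m)%N -> 0 <= a 1%N q.+1.
    case: tri => _ bd _ _; have [b0 _] := bd 1%N isT.
    elim: q => [|q IH] qm; first by have := row 1%N 0%N isT isT; rewrite [a 1%N 0%N]b0.
    by apply: le_trans (IH _) (row 1%N q.+1 _ _); lia.
  have rowc d q : (q + d = m)%N -> a 1%N q.+1 <= c%:Z.
    case: tri => _ bd _ _; have [_ bc] := bd 1%N isT.
    elim: d q => [|d IH] q qm; first by rewrite -bc -qm addn0; apply: row; lia.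
    by apply: le_trans (row 1%N q.+1 _ _) (IH q.+1 _); lia.
  exists (mkseq (fun q => absz (a 1%N q.+1 + q%:Z)) m.+1).
    rewrite memX size_mkseq eqxx andTb; apply/andP; split.
      apply/(sortedP 0%N) => i; rewrite size_mkseq => im; rewrite !nth_mkseq //;
        last by lia.
      have := row 1%N i.+1 isT ltac:(lia); have := row0 i ltac:(lia);
        have := row0 i.+1 ltac:(lia).
      by rewrite /ltn /=; lia.
    apply/allP => s /mapP[q]; rewrite mem_iota => qm ->.
    by have := row0 q ltac:(lia); have := rowc (m - q)%N q ltac:(lia); lia.
  split=> // q qm; rewrite nth_mkseq; last by lia.
  by have := row0 q qm; lia.
apply: has_card_bigcup; first by rewrite filter_uniq // subseqs_uniq.
- move=> y; rewrite memX => /and3P[/eqP szy sy ay]; apply: has_card_arrays_with_row => //.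
  case: y szy {sy} ay => //= u v _ /andP[hu hv].
  by have := mem_last u v; rewrite inE => /predU1P[->//|/(allP hv)].
move=> y y' a; rewrite !memX => /and3P[/eqP szy _ _] /and3P[/eqP szy' _ _] [_ ry] [_ ry'].
apply: (@eq_from_nth _ 0%N) => [|q]; rewrite szy // => qm.
by have := ry q qm; rewrite ry' //; lia.
Qed.

(** * Strict plane partitions and their layers *)

(** A predicate closed downward holds exactly below its number of solutions; this
    is the Galois connection behind the conjugation of partitions. *)
Lemma count_down (P : pred nat) L q : (forall i, P i.+1 -> P i) ->
  (q < count P (iota 0 L))%N = (q < L)%N && P q.
Proof.
move=> Pd; have Ple i j : (i <= j)%N -> P j -> P i.
  by move=> /subnKC <-; elim: (j - i)%N => [|d IH]; rewrite ?addn0 // addnS => /Pd.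
elim: L => // L IH; rewrite -{1}[L.+1]addn1 iotaD count_cat /= add0n addn0.
case: (boolP (P L)) => PL.
  have -> : count P (iota 0 L) = L.
    rewrite -[RHS](size_iota 0) ; apply/eqP; rewrite -all_count; apply/allP => i.
    by rewrite mem_iota => iL; apply: Ple PL; lia.
  rewrite addn1 ltnS; case: (leqP q L) => //= qL; exact/esym/Ple/PL.
rewrite addn0 IH ltnS [in RHS]leq_eqVlt; case: eqP => [->|//].
by rewrite ltnn (negbTE PL).
Qed.

Lemma eq_from_ltn x y : (forall i, (i < x)%N = (i < y)%N) -> x = y.
Proof.
by move=> h; case: (ltngtP x y) => // xy; [have := h x|have := h y]; rewrite ltnn xy.
Qed.

Lemma count_nth (P : pred nat) s : count P s = count (fun q =>
  P (nth 0%N s q)) (iota 0 (size s)).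
Proof. by rewrite -[in LHS](mkseq_nth 0%N s) count_map. Qed.

(** Row n - j of the plane partition gives column j of the array: the parts >= i of
    that row, for all i, form the partition conjugate to it. *)
Definition threshold_array (n c : nat) (pi : seq (seq nat)) (i j : nat) : int :=
  if gt_index n.-1 n i j then
    if (j < i)%N then 0 else if j == n.+1 then c%:Z
    else (count (leq i) (nth [::] pi (n - j)))%:Z
  else 0.

(** The inverse of [threshold_array]: a part is the number of the layers that
    contain its position.  The rows are those that are not empty. *)
Definition layered_partition (n : nat) (a : nat -> nat -> int) : seq (seq nat) :=
  mkseq (fun p => mkseq (fun q => count (fun i => q%:Z < a i.+1 (n - p)%N) (iota 0 (n - p)))
                        (absz (a 1%N (n - p)%N)))
        (count (fun p => 0 < a 1%N (n - p)%N) (iota 0 n)).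

Lemma nth_shape (pi : seq (seq nat)) p : nth 0%N (shape pi) p = size (nth [::] pi p).
Proof. by rewrite /shape; elim: pi p => [|r pi IH] [|p] /=; rewrite ?nth_nil. Qed.

Lemma part_out pi p q : (size (nth [::] pi p) <= q)%N -> part pi p q = 0%N.
Proof. exact: nth_default. Qed.

Lemma shape_decreasing (pi : seq (seq nat)) p : is_partition (shape pi) ->
  (nth 0 (shape pi) p.+1 <= nth 0 (shape pi) p)%N.
Proof.
move=> /andP[sp _]; case: (ltnP p.+1 (size (shape pi))) => h; last by rewrite nth_default.
exact: (sortedP 0%N sp).
Qed.

Lemma partition_row_pos (pi : seq (seq nat)) p : is_partition (shape pi) ->
  (p < size pi)%N -> (0 < size (nth [::] pi p))%N.
Proof.
move=> /andP[_ s0] hp; rewrite lt0n; apply: contra s0 => /eqP e.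
by rewrite -e -nth_shape mem_nth // size_map.
Qed.

Section SPP.
Variables (n : nat) (pi : seq (seq nat)).
Hypothesis spp : strict_plane_partition pi.
Hypothesis parts : all (fun x => (1 <= x <= n)%N) (flatten pi).

Lemma spp_part_bounds p q : (q < size (nth [::] pi p))%N -> (1 <= part pi p q <= n)%N.
Proof.
move=> hq; have hp : (p < size pi)%N by rewrite ltnNge; apply/negP => h;
  rewrite nth_default in hq.
apply: (allP parts); apply/flattenP; exists (nth [::] pi p); first exact: mem_nth.
exact: mem_nth.
Qed.

Lemma spp_part_pos p q : (0 < part pi p q)%N = (q < size (nth [::] pi p))%N.
Proof.
by case: (ltnP q (size (nth [::] pi p))) => [/spp_part_bounds/andP[]|h] //;
  rewrite part_out.
Qed.

(** Columns decrease strictly, so row p has no part above n - p.  In particular only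
    the first row contains n. *)
Lemma spp_part_le p q : (part pi p q <= n - p)%N.
Proof.
case: (ltnP q (size (nth [::] pi p))) => hq; last by rewrite part_out.
elim: p hq => [|p IH] hq; first by rewrite subn0; have /andP[] := spp_part_bounds hq.
have [ip _ col] := spp.
have hq' : (q < size (nth [::] pi p))%N.
  by have := shape_decreasing p ip; rewrite !nth_shape; lia.
have hp : (p.+1 < size pi)%N by rewrite ltnNge; apply/negP => h; rewrite nth_default in hq.
by have := col p q hp; rewrite nth_shape => /(_ hq); have := IH hq'; lia.
Qed.

Lemma spp_row_decreasing p q : (part pi p q.+1 <= part pi p q)%N.
Proof.
case: (ltnP q.+1 (size (nth [::] pi p))) => hq; last by rewrite part_out.
have hp : (p < size pi)%N by rewrite ltnNge; apply/negP => h; rewrite nth_default in hq.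
by have [_ row _] := spp; apply: row => //; rewrite nth_shape.
Qed.

Lemma spp_count_row p q i : (q < count (leq i.+1) (nth [::] pi p))%N = (i < part pi p q)%N.
Proof.
rewrite count_nth count_down => [|j hj]; last exact: leq_trans hj (spp_row_decreasing p j).
by rewrite -/(part pi p q); case: ltnP => //= h; rewrite part_out.
Qed.

Lemma spp_count_max : (0 < n)%N -> count_mem n (flatten pi) = count (leq n) (nth [::] pi 0).
Proof.
move=> n0.
have -> : count_mem n (flatten pi) = count (leq n) (flatten pi).
  by apply: eq_in_count => x /(allP parts) /andP[_ xn] /=; rewrite eqn_leq xn.
have := spp_part_le; case: pi => [//|r pi'] le_part /=.
rewrite count_cat [X in (_ + X)%N](_ : _ = 0%N) ?addn0 //.
apply/eqP; rewrite -leqn0 leqNgt -has_count; apply/hasPn => x /flattenP[s].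
move=> /(nthP [::])[p _ <-] /(nthP 0)[q _ <-]; rewrite -ltnNge -/(part pi' p q).
by have : (part pi' p q <= n - p.+1)%N := le_part p.+1 q; lia.
Qed.
End SPP.

Lemma spp_ext n pi pi' :
  strict_plane_partition pi -> all (fun x => (1 <= x <= n)%N) (flatten pi) ->
  strict_plane_partition pi' -> all (fun x => (1 <= x <= n)%N) (flatten pi') ->
  (forall p q, part pi p q = part pi' p q) -> pi = pi'.
Proof.
move=> s1 b1 s2 b2 e.
have szrow p : size (nth [::] pi p) = size (nth [::] pi' p).
  by apply: eq_from_ltn => q; rewrite -(spp_part_pos b1) -(spp_part_pos b2) e.
have szpos (rho : seq (seq nat)) : strict_plane_partition rho ->
    forall p, (p < size rho)%N = (0 < size (nth [::] rho p))%N.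
  move=> [ip _ _] p; case: (ltnP p (size rho)) => hp; first by rewrite partition_row_pos.
  by rewrite nth_default.
apply: (@eq_from_nth _ [::]) => [|p _].
  by apply: eq_from_ltn => p; rewrite !szpos // szrow.
by apply: (@eq_from_nth _ 0%N) => [|q _]; [exact: szrow | exact: e].
Qed.

Section Bij.
Variables (m c k : nat).
Hypothesis kc : (k <= c)%N.
Let n := m.+1.

Section Tri.
Variable a : nat -> nat -> int.
Hypothesis tri : monotone_array m c k a.

Lemma array_row_le i j j' : (1 <= i <= n)%N -> (i.-1 <= j <= j')%N -> (j' <= n.+1)%N ->
  a i j <= a i j'.
Proof.
move=> hi /andP[hj /subnKC <-]; elim: (j' - j)%N => [|d IH] hd; first by rewrite addn0.
rewrite addnS in hd *; apply: le_trans (IH _) _; first by lia.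
by apply: (monotone_array_row kc tri); lia.
Qed.

Lemma array_range i j : 0 <= a i j <= c%:Z.
Proof.
have [a0 bd _ _] := tri.
case: (boolP (gt_index m m.+1 i j)) => [|/a0 -> //]; rewrite /gt_index => hij.
have [b0 bc] := bd i ltac:(lia); apply/andP; split.
  by rewrite -[X in X <= _]b0; apply: array_row_le; lia.
by rewrite -bc; apply: array_row_le; lia.
Qed.

Lemma array_support i j : 0 < a i j -> [/\ (1 <= i <= n)%N, (i <= j)%N & (j <= n.+1)%N].
Proof.
have [a0 bd _ _] := tri.
case: (boolP (gt_index m m.+1 i j)) => [|/a0 -> //]; rewrite /gt_index => hij.
have [b0 _] := bd i ltac:(lia); have [->|] := eqVneq j i.-1; first by rewrite b0.
by move=> *; split; lia.
Qed.

Lemma array_col_le i j : (j <= n)%N -> a i.+2 j <= a i.+1 j.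
Proof.
move=> jn; case: (ltrP 0 (a i.+2 j)) => [/array_support[hi hj _]|h].
  by have [_ _ H _] := tri; have := H i.+1 j ltac:(lia) ltac:(lia); lia.
by have := array_range i.+1 j; lia.
Qed.

Lemma array_diag_le i j : (j < n)%N -> a i j <= a i.+1 j.+1.
Proof.
move=> jn; case: (ltrP 0 (a i j)) => [/array_support[hi hj _]|h].
  have [_ _ H _] := tri.
  by have := H i j ltac:(lia) ltac:(lia); lia.
by have := array_range i.+1 j.+1; lia.
Qed.

Lemma array_row1_le p : a 1%N (n - p.+1)%N <= a 1%N (n - p)%N.
Proof. by apply: array_row_le; lia. Qed.

Let pi := layered_partition n a.

Lemma size_layered p : (p < size pi)%N = (0 < a 1%N (n - p)%N).
Proof.
rewrite size_mkseq count_down => [|q /lt_le_trans]; last by apply; exact: array_row1_le.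
case: ltnP => //= np; have [_ bd _ _] := tri; have [b0 _] := bd 1%N isT.
by rewrite (_ : (n - p = 0)%N) ?[a 1%N 0%N]b0 //; lia.
Qed.

Lemma nth_layered p : nth [::] pi p =
  mkseq (fun q => count (fun i =>
    q%:Z < a i.+1 (n - p)%N) (iota 0 (n - p))) (absz (a 1%N (n - p)%N)).
Proof.
case: (ltnP p (size pi)) => hp; first by rewrite nth_mkseq //; move: hp; rewrite size_mkseq.
rewrite nth_default //; move: hp; rewrite leqNgt size_layered.
by have := array_range 1%N (n - p)%N; case: (a _ _) => [[|]|].
Qed.

Lemma size_row_layered p : size (nth [::] pi p) = absz (a 1%N (n - p)%N).
Proof. by rewrite nth_layered size_mkseq. Qed.

(** Valid for all p, q and i, because the array vanishes outside its triangle.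
    Everything about [layered_partition] follows from this equivalence. *)
Lemma part_layered p q i : (i < part pi p q)%N = (q%:Z < a i.+1 (n - p)%N).
Proof.
have r0 := array_range 1%N (n - p)%N.
have le1 : a i.+1 (n - p)%N <= a 1%N (n - p)%N.
  by elim: i => // i IH; apply: le_trans IH; apply: array_col_le; lia.
case: (ltnP q (size (nth [::] pi p))) => hq; last first.
  by rewrite part_out // ltn0; move: hq; rewrite size_row_layered; lia.
rewrite /part nth_layered; move: hq; rewrite size_row_layered => hq; rewrite nth_mkseq //.
rewrite count_down => [|j /lt_le_trans]; last by apply; apply: array_col_le; lia.
case: ltnP => //= h; apply/esym/negbTE; rewrite -leNgt.
case: (ltrP 0 (a i.+1 (n - p)%N)) => [/array_support[]|]; lia.
Qed.

(** Rows decrease because the condition q < a_{i, j} is closed downward in q.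
    Columns decrease strictly because a_{i, j} <= a_{i + 1, j + 1}, which makes one
    more layer available in the row above. *)
Lemma layered_spp : strict_plane_partition pi.
Proof.
split.
- apply/andP; split.
    apply/(sortedP 0%N) => p _; rewrite !nth_shape !size_row_layered /=.
    by have := array_row1_le p; have := array_range 1%N (n - p.+1)%N; lia.
  apply/negP => /(nthP 0%N)[p]; rewrite nth_shape size_map size_layered size_row_layered;
    lia.
- move=> p q _ _; rewrite leqNgt part_layered -leNgt.
  have /negbT := ltnn (part pi p q); rewrite part_layered; lia.
move=> p q _; rewrite nth_shape size_row_layered => hq.
rewrite part_layered; case e : (part pi p.+1 q) => [|t].
  by have := array_row1_le p; have := array_range 1%N (n - p.+1)%N; lia.
have : (t < part pi p.+1 q)%N by rewrite e.
rewrite part_layered => /lt_le_trans; apply.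
have jE : (n - p = (n - p.+1).+1)%N.
  suff : (0 < n - p.+1)%N by lia.
  rewrite lt0n; apply/negP => /eqP j0; move: hq; rewrite j0.
  by have [_ bd _ _] := tri; have [b0 _] := bd 1%N isT; rewrite [a 1%N 0%N]b0.
by rewrite jE; apply: array_diag_le; lia.
Qed.

Lemma layered_parts : all (fun x => (1 <= x <= n)%N) (flatten pi).
Proof.
apply/allP => x /flattenP[s] /(nthP [::])[p _ <-] /(nthP 0%N)[q hq <-].
rewrite -/(part pi p q) part_layered leqNgt part_layered.
move: hq; rewrite size_row_layered => hq; have := array_range 1%N (n - p)%N.
case: (ltrP 0 (a n.+1 (n - p)%N)) => [/array_support[]|]; lia.
Qed.

Lemma threshold_layered : threshold_array n c pi = a.
Proof.
have [a0 bd _ ak] := tri.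
apply/funext => i; apply/funext => j; rewrite /threshold_array [n.-1]/=.
case: ifPn => [|/a0 //]; rewrite /gt_index => hij.
have [b0 bc] := bd i ltac:(lia).
case: ltnP => ij; first by rewrite (_ : j = i.-1) ?b0 //; lia.
case: eqP => [->|jn]; first by rewrite bc.
case: i hij ij {b0 bc} => // i hij ij.
suff -> : count (leq i.+1) (nth [::] pi (n - j)) = absz (a i.+1 j).
  by have := array_range i.+1 j; lia.
apply: eq_from_ltn => q; rewrite (spp_count_row layered_spp) part_layered.
rewrite subKn; last by lia.
by have := array_range i.+1 j; lia.
Qed.

Lemma layered_in : strict_plane_partitions n c k pi.
Proof.
split; [exact: layered_spp|exact: layered_parts| |].
  by rewrite -nth0 nth_shape size_row_layered; have := array_range 1%N (n - 0)%N; lia.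
rewrite (spp_count_max layered_spp layered_parts) //.
have [_ _ _ ak] := tri; have := congr1 (fun h => h n n) threshold_layered.
rewrite /threshold_array ak ifT; last by rewrite /gt_index; lia.
by rewrite ltnn ifN ?subnn => [[]|]; lia.
Qed.

End Tri.

Lemma threshold_monotone pi : strict_plane_partitions n c k pi ->
  monotone_array m c k (threshold_array n c pi).
Proof.
move=> [spp parts headc cntk].
have thE i j : (1 <= i <= j)%N -> (j <= n)%N ->
    threshold_array n c pi i j = (count (leq i) (nth [::] pi (n - j)))%:Z.
  by move=> hi hj; rewrite /threshold_array ifT ?ifN //; rewrite /gt_index /n; lia.
have bd i : (1 <= i <= n)%N ->
  threshold_array n c pi i i.-1 = 0 /\ threshold_array n c pi i n.+1 = c.
  move=> hi; split; rewrite /threshold_array ifT; try by rewrite /gt_index /n; lia.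
    by rewrite ifT //; lia.
  by rewrite ifN ?eqxx //; lia.
have th0 i j : 0 <= threshold_array n c pi i j.
  by rewrite /threshold_array; case: ifP => // _; case: ifP => // _; case: ifP.
split=> //.
- by move=> i j /negbTE h; rewrite /threshold_array h.
- move=> i j hi hj; apply/andP; split.
    have [->|ij] := eqVneq j i; first by have [-> _] := bd i.+1 ltac:(rewrite /n; lia).
    rewrite !thE ?lez_nat; try by rewrite /n; lia.
    by apply: sub_count => x /=; lia.
  have [->|jn] := eqVneq j n.
    have [_ ->] := bd i.+1 ltac:(rewrite /n; lia).
    rewrite thE ?subnn /n ?lez_nat; [|lia|lia].
    by apply: leq_trans (count_size _ _) _; rewrite -nth_shape nth0.
  rewrite !thE ?lez_nat; try by rewrite /n in jn *; lia.
  rewrite leqNgt; apply/negP.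
  case: i hi hj => // i hi hj; rewrite (spp_count_row spp) => h.
  set q := count _ _ in h.
  have : (q < q)%N; last by rewrite ltnn.
  rewrite {2}/q (spp_count_row spp).
  have [_ _ col] := spp.
  have e : (n - j = (n - j.+1).+1)%N by rewrite /n in jn *; lia.
  have hq : (q < size (nth [::] pi (n - j.+1).+1))%N by rewrite -(spp_part_pos parts) -e;
    lia.
  have hp : ((n - j.+1).+1 < size pi)%N by rewrite ltnNge; apply/negP => h';
    rewrite nth_default in hq.
  by have := col _ q hp; rewrite nth_shape -e => /(_ ltac:(rewrite e; exact: hq)); lia.
rewrite -/n thE; [|by rewrite /n; lia|by []].
by rewrite subnn -(spp_count_max spp parts) // cntk.
Qed.

Lemma layered_threshold pi : strict_plane_partitions n c k pi ->
  layered_partition n (threshold_array n c pi) = pi.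
Proof.
move=> pi_in; have tri := threshold_monotone pi_in; case: pi_in => spp parts _ _.
apply: (spp_ext (layered_spp tri) (layered_parts tri) spp parts) => p q.
apply: eq_from_ltn => i; rewrite (part_layered tri) /threshold_array.
have part_le := spp_part_le spp parts p q.
case: ifP => [hij|/negbT]; last by rewrite /gt_index /n; lia.
case: ltnP => [ij|ij]; first by lia.
rewrite ifN; last by rewrite /n; lia.
case: (ltnP p n) => pn.
  by rewrite (subKn (ltnW pn)) ltz_nat; exact: (spp_count_row spp).
lia.
Qed.

Lemma has_card_spp : has_card (strict_plane_partitions n c k) (count_arrays m (c + n) k).
Proof.
apply: has_card_ext (has_card_image (g := layered_partition n) _ (has_card_arrays m kc)).
  move=> pi; split=> [[a tri ->]|pi_in]; first exact: layered_in.
  exists (threshold_array n c pi); first exact: threshold_monotone.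
  by rewrite layered_threshold.
by move=> a b ta tb e; rewrite -(threshold_layered ta) -(threshold_layered tb) e.
Qed.
End Bij.

Lemma has_card_unique (T : eqType) (P : T -> Prop) M N :
  has_card P M -> has_card P N -> M = N.
Proof.
move=> [s [us <- sP]] [t [ut <- tP]]; apply: perm_size; apply: uniq_perm => // a.
by apply/idP/idP => [/sP/tP|/tP/sP].
Qed.

Lemma has_card_set (T : choiceType) (A : set T) N : has_card A N ->
  finite_set A /\ #|` fset_set A|%fset = N.
Proof.
move=> [s [us <- sP]].
have AE : A = [set` s]%classic by apply/seteqP; split=> a /sP.
have fA : finite_set A by rewrite AE; exact: finite_seq.
split=> //; rewrite -(undup_id us) -card_fseq; congr (size _); congr enum_fset.
by apply/fsetP => a; rewrite in_fset_set // inE; apply/idP/idP => [/set_mem/sP|/sP/mem_set].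
Qed.

(** * The constant factor *)

Lemma count_arrays_F m c k : (k <= c)%N ->
  F (r := m) (n := m.+1) c%:Z (fun=> k%:Z) = (count_arrays m (c + m.+1) k)%:Z.
Proof.
move=> kc; have [s [us <- sP]] := has_card_arrays m kc.
rewrite /F (_ : gt_patterns_top _ _ = [set` s]%classic); last first.
  apply/seteqP; split=> a; first by move=> ta; apply/sP/gt_patterns_topP.
  by move=> sa; apply/gt_patterns_topP => //; apply/sP.
rewrite -fsbig_seq // big_seq (eq_bigr (fun=> 1)) => [|a /sP];
  last exact: monotone_array_sgn.
by rewrite -big_seq big_const_seq count_predT iter_addr_0 natz.
Qed.

(** Both sides count the plane partitions with parts at most m + 1, on the left as
    those with parts at most m + 2 and no part m + 2, on the right by the number of
    parts m + 1, which all lie in the first row. *)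
Lemma count_arrays_rec m c :
  (count_arrays m.+1 (c + m.+2) 0 = \sum_(0 <= k < c.+1) count_arrays m (c + m.+1) k)%N.
Proof.
apply: has_card_unique (has_card_spp m.+1 (leq0n c)) _.
apply: (@has_card_ext _ (fun pi => exists2 k, k \in index_iota 0 c.+1 &
    strict_plane_partitions m.+1 c k pi)).
  move=> pi; split.
    move=> [k _ [spp parts headc _]]; split=> //.
      by apply: sub_all parts => x; lia.
    by apply/count_memPn/negP => /(allP parts); rewrite ltnn andbF.
  move=> [spp parts headc cnt0].
  have parts' : all (fun x => 1 <= x <= m.+1)%N (flatten pi).
    apply/allP => x xpi; have := allP parts x xpi.
    have : x != m.+2 by apply: contraTneq xpi => ->; exact/count_memPn.
    lia.
  exists (count_mem m.+1 (flatten pi)); last by split.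
  rewrite mem_index_iota ltnS (spp_count_max spp parts') //=.
  by apply: leq_trans (count_size _ _) _; rewrite -nth_shape nth0.
apply: has_card_bigcup; first exact: iota_uniq.
  by move=> k; rewrite mem_index_iota ltnS => kc; exact: has_card_spp.
by move=> k k' pi _ _ [_ _ _ <-] [_ _ _ <-].
Qed.

Lemma pochhammer_fact (a m : nat) :
  pochhammer (a.+1%:R : rat) m = (a + m)`!%:R / a`!%:R.
Proof.
have a0 : a`!%:R != 0 :> rat by rewrite pnatr_eq0 -lt0n fact_gt0.
rewrite /pochhammer; elim: m => [|m IH]; first by rewrite big_geq // addn0 divff.
rewrite big_nat_recr //= IH addnS factS natrM -natrD addSn; field.
by rewrite a0.
Qed.

(** [bin_convolution] with the vanishing terms y < m removed. *)
Lemma sum_bin_shifted c m :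
  (\sum_(0 <= k < c.+1) 'C(k + m, m) * 'C(c - k + m, m) = 'C(c + m + m.+1, m + m.+1))%N.
Proof.
rewrite -bin_convolution -(big_mkord xpredT (fun y => 'C(y, m) * 'C(c + m - y + m, m))%N).
rewrite [RHS](big_cat_nat (n := m)) //=; last by lia.
rewrite [X in (_ = X + _)%N](_ : _ = 0%N) ?add0n; last first.
  by rewrite big_nat big1 // => y ym; rewrite bin_small //; lia.
rewrite (big_addn 0 _ m) -addSn addnK; apply: eq_bigr => k _.
by rewrite subnDr.
Qed.

Definition constant_factor (m c : nat) : rat :=
  (pochhammer 1 m)^-1 *
  \prod_(1 <= i < m.+1) (pochhammer (c%:R + i%:R + 1) i.-1 / pochhammer i%:R i).

Lemma constant_factor_succ m c : constant_factor m.+1 c = constant_factor m c *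
  ((c + m + m.+1)`!%:R * m`!%:R / (m.+1%:R * (c + m.+1)`!%:R * (m + m.+1)`!%:R)).
Proof.
have f0 a : a`!%:R != 0 :> rat by rewrite pnatr_eq0 -lt0n fact_gt0.
have mm : m.+1%:R != 0 :> rat by rewrite pnatr_eq0.
rewrite /constant_factor big_nat_recr //= -[X in pochhammer X]/(1%:R).
rewrite -natrD natr1 !pochhammer_fact !add0n -[m.+1`!]/(m.+1 * m`!)%N natrM.
have -> : (c + m.+1 + m = c + m + m.+1)%N by lia.
by field; rewrite !f0 addrC natr1 mm.
Qed.

(** The factor in [count_arrays_product] is read off at k = 0, where
    [count_arrays_rec] expresses the count by the previous level; the sum is then a
    convolution of binomial coefficients. *)
Lemma count_arrays_closed m c k : (k <= c)%N ->
  (count_arrays m (c + m.+1) k)%:R =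
  constant_factor m c * (pochhammer (1 + k%:R) m * pochhammer (1 + c%:R - k%:R) m).
Proof.
have f0 a : a`!%:R != 0 :> rat by rewrite pnatr_eq0 -lt0n fact_gt0.
have pochE a : 1 + a%:R = a.+1%:R :> rat by rewrite -natr1 addrC.
have prodE a b : (b <= a)%N -> 1 + a%:R - b%:R = (a - b).+1%:R :> rat.
  by move=> ba; rewrite pochE -natrB ?subSn // leqW.
have poch_bin a d : pochhammer (a.+1%:R : rat) d = d`!%:R * 'C(a + d, d)%:R.
  by rewrite pochhammer_fact -(bin_fact (leq_addl a d)) addnK !natrM; field; rewrite f0.
elim: m c k => [|m IH] c k kc.
  by rewrite count_arrays0 // /constant_factor /pochhammer !big_geq // invr1 !mulr1.
have [t tP] := count_arrays_product m c.
rewrite tP //; congr (_ * _).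
have := tP 0%N isT; rewrite count_arrays_rec natr_sum.
rewrite (eq_big_nat _ _ (F2 := fun k =>
  constant_factor m c * (m`! * m`!)%:R * ('C(k + m, m) * 'C(c - k + m, m))%:R)).
  rewrite -mulr_sumr -natr_sum sum_bin_shifted addr0 subr0 pochE
    -[X in pochhammer X]/(1%:R) !poch_bin.
  rewrite constant_factor_succ add0n binn mulr1 => tE.
  have c0 : (m.+1`!%:R * (m.+1`!%:R * 'C(c + m.+1, m.+1)%:R)) != 0 :> rat.
    by rewrite !mulf_neq0 // pnatr_eq0 -lt0n bin_gt0 leq_addl.
  apply: (mulIf c0); rewrite -tE {t tP tE}.
  have binE d : (c + d)`!%:R = 'C(c + d, d)%:R * (d`!%:R * c`!%:R) :> rat.
    by rewrite -!natrM -{3}(addnK d c) bin_fact // leq_addl.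
  have fS : m.+1`!%:R = m.+1%:R * m`!%:R :> rat by rewrite -natrM -factS.
  have mm : 1 + m%:R != 0 :> rat by rewrite pochE pnatr_eq0.
  have b1 : 'C(c + m.+1, m.+1)%:R != 0 :> rat by rewrite pnatr_eq0 -lt0n bin_gt0 leq_addl.
  by rewrite -addnA !binE fS natrM; field; rewrite !f0 mm b1.
move=> i /andP[_ ic]; rewrite IH // pochE prodE // !poch_bin !natrM; ring.
Qed.

Unset Implicit Arguments.

Theorem theorem2 (n c k : nat) (hn : (1 <= n)%N) (hk : (k <= c)%N) :
  [/\ finite_set (strict_plane_partitions n c k),
      (#|` fset_set (strict_plane_partitions n c k)|)%fset%:Z
        = F (r := n.-1) (n := n) c%:Z (fun=> k%:Z)
    & (F (r := n.-1) (n := n) c%:Z (fun=> k%:Z))%:~R =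
        pochhammer (1 + k%:R) n.-1 * pochhammer (1 + c%:R - k%:R) n.-1
          / pochhammer 1 n.-1
        * \prod_(1 <= i < n)
            (pochhammer (c%:R + i%:R + 1) i.-1 / pochhammer i%:R i) :> rat].
Proof.
case: n hn => // m _; have [fin card] := has_card_set (has_card_spp m hk).
rewrite [m.+1.-1]/= count_arrays_F // card; split=> //.
rewrite -[LHS]/((count_arrays m (c + m.+1) k)%:R) count_arrays_closed // /constant_factor.
by rewrite mulrC mulrA.
Qed.
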